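(* Let $\pi:(M^3,g)\to(N^2,h)$ be a Riemannian submersion with adapted frame $\{e_1,e_2,e_3\}$ and integrability data $\{f_1,f_2,\kappa_1,\kappa_2,\sigma\}$, and let $f:M\to(0,+\infty)$. Then $\pi$ is $f$-biharmonic if and only if $$\begin{cases} -\Delta^M(f\kappa_1)-2\sum_{i=1}^2f_ie_i(f\kappa_2)-f\kappa_2\sum_{i=1}^2\big(e_i(f_i)-\kappa_if_i\big)+f\kappa_1\Big(-K^N+\sum_{i=1}^2f_i^2\Big)=0,\\ -\Delta^M(f\kappa_2)+2\sum_{i=1}^2f_ie_i(f\kappa_1)+f\kappa_1\sum_{i=1}^2\big(e_i(f_i)-\kappa_if_i\big)+f\kappa_2\Big(-K^N+\sum_{i=1}^2f_i^2\Big)=0, \end{cases}$$ where $K^N=R^N_{1212}\circ\pi=e_1(f_2)-e_2(f_1)-f_1^2-f_2^2$ is the Gauss curvature of $(N^2,h)$.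
   Context: An adapted frame of $\pi$ is an orthonormal frame $\{e_1,e_2,e_3\}$ on $M$ with $e_3$ vertical and $e_1,e_2$ basic horizontal, $d\pi(e_i)=\varepsilon_i$ ($i=1,2$) with $\{\varepsilon_1,\varepsilon_2\}$ an orthonormal frame on $N$. The integrability data are the functions $f_1,f_2,\kappa_1,\kappa_2,\sigma\in C^\infty(M)$ defined by $$[e_1,e_3]=\kappa_1e_3,\quad[e_2,e_3]=\kappa_2e_3,\quad[e_1,e_2]=f_1e_1+f_2e_2-2\sigma e_3.$$ $\Delta^M$ is the Laplacian $\mathrm{div}\,\mathrm{grad}$ on $(M,g)$. For a map $\varphi:(M,g)\to(N,h)$, $\tau(\varphi)=\mathrm{Trace}_g\nabla d\varphi$, $\tau_2(\varphi)=\mathrm{Trace}_g(\nabla^\varphi\nabla^\varphi-\nabla^\varphi_{\nabla^M})\tau(\varphi)-\mathrm{Trace}_gR^N(d\varphi,\tau(\varphi))d\varphi$, with $R^N(X,Y)Z=[\nabla_X,\nabla_Y]Z-\nabla_{[X,Y]}Z$, and $\varphi$ is $f$-biharmonic if $f\tau_2(\varphi)+(\Delta f)\tau(\varphi)+2\nabla^\varphi_{\mathrm{grad}f}\tau(\varphi)=0$. *)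

(* Defs.v *)
From mathcomp Require Import all_boot all_order all_algebra.
From mathcomp Require Import all_classical all_reals all_analysis.
Import numFieldNormedType.Exports.

Set Implicit Arguments.
Unset Strict Implicit.
Unset Printing Implicit Defensive.

Import Order.TTheory GRing.Theory Num.Theory.
Local Open Scope classical_set_scope.
Local Open Scope ring_scope.

(* [Ck_on k U f]: f is of class C^k on the open set U (Frechet
   differentiability, iterated on the directional derivatives). *)
Fixpoint Ck_on (R : realType) (n k : nat) (U : set 'rV[R]_n)
    (f : 'rV[R]_n -> R) : Prop :=
  if k is k'.+1 then
    (forall x, U x -> differentiable f x) /\
    (forall v : 'rV[R]_n, Ck_on k' U (fun x => 'D_v f x))
  else forall x, U x -> {for x, continuous f}.

Definition smooth_on (R : realType) (n : nat) (U : set 'rV[R]_n)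
    (f : 'rV[R]_n -> R) : Prop :=
  forall k, Ck_on k U f.

(* The values of [chart_map] outside [chart_dom], and of [chart_inv] outside
   the image of [chart_dom], are irrelevant. *)
Record chart (R : realType) (n : nat) (T : topologicalType) := Chart {
  chart_dom : set T;
  chart_map : T -> 'rV[R]_n;
  chart_inv : 'rV[R]_n -> T;
  chart_dom_open : open chart_dom;
  chart_img_open : open (chart_map @` chart_dom);
  chart_map_cont : {within chart_dom, continuous chart_map};
  chart_inv_cont : {within chart_map @` chart_dom, continuous chart_inv};
  chart_mapK : forall p, chart_dom p -> chart_inv (chart_map p) = p }.

Record smoothManifold (R : realType) (n : nat) := SmoothManifold {
  carrier :> topologicalType;
  hausdorff_carrier : hausdorff_space carrier;
  second_countable_carrier : @second_countable carrier;
  atlas : set (chart R n carrier);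
  atlas_cover : forall p : carrier, exists2 c, atlas c & chart_dom c p;
  atlas_smooth : forall c d, atlas c -> atlas d -> forall i : 'I_n,
    smooth_on (chart_map c @` (chart_dom c `&` chart_dom d))
      (fun x => chart_map d (chart_inv c x) ord0 i) }.

(* C^oo(M) *)
Definition smooth (R : realType) (n : nat) (M : smoothManifold R n)
    (a : M -> R) : Prop :=
  forall c, atlas c ->
    smooth_on (chart_map c @` chart_dom c) (fun x => a (chart_inv c x)).

Definition smooth_map (R : realType) (m n : nat) (M : smoothManifold R m)
    (N : smoothManifold R n) (phi : M -> N) : Prop :=
  continuous phi /\
  forall (c : chart R m M) (d : chart R n N), atlas c -> atlas d ->
  forall i : 'I_n,
    smooth_on (chart_map c @` (chart_dom c `&` phi @^-1` chart_dom d))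
      (fun x => chart_map d (phi (chart_inv c x)) ord0 i).

(* Tangent vectors at p are the point derivations of C^oo(M) at p.  To have
   them as elements of one ambient vector space, they are functionals on all
   real functions, vanishing by convention on the non-smooth ones: equality of
   tangent vectors is then Leibniz equality. *)
Definition tvec (R : realType) (n : nat) (M : smoothManifold R n) : Type :=
  (M -> R) -> R.

Record tangent (R : realType) (n : nat) (M : smoothManifold R n) (p : M)
    (v : tvec M) : Prop := Tangent {
  tangent_junk : forall a, ~ smooth a -> v a = 0;
  tangent_linear : forall (c : R) (a b : M -> R), smooth a -> smooth b ->
    v (fun q => c * a q + b q) = c * v a + v b;
  tangent_leibniz : forall a b : M -> R, smooth a -> smooth b ->
    v (fun q => a q * b q) = v a * b p + a p * v b }.

(* The differential of phi.  The case distinction only enforces the convention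
   on non-smooth functions made for tangent vectors. *)
Definition dmap (R : realType) (m n : nat) (M : smoothManifold R m)
    (N : smoothManifold R n) (phi : M -> N) (v : tvec M) : tvec N :=
  fun b => if `[< smooth b >] then v (fun p => b (phi p)) else 0.

(* Smooth sections of the pullback bundle phi^{-1}TN. *)
Definition field_along (R : realType) (m n : nat) (M : smoothManifold R m)
    (N : smoothManifold R n) (phi : M -> N) (V : M -> tvec N) : Prop :=
  (forall p, tangent (phi p) (V p)) /\
  (forall b : N -> R, smooth b -> smooth (fun p => V p b)).

Definition vfield (R : realType) (n : nat) (M : smoothManifold R n)
    (X : M -> tvec M) : Prop :=
  field_along id X.

Definition bracket (R : realType) (n : nat) (M : smoothManifold R n)
    (X Y : M -> tvec M) : M -> tvec M :=
  fun p a => X p (fun q => Y q a) - Y p (fun q => X q a).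

Record riemannian_metric (R : realType) (n : nat) (M : smoothManifold R n)
    (g : M -> tvec M -> tvec M -> R) : Prop := RiemannianMetric {
  metric_linear : forall p (c : R) (u v w : tvec M),
    tangent p u -> tangent p v -> tangent p w ->
    g p (c *: u + v) w = c * g p u w + g p v w;
  metric_sym : forall p (v w : tvec M), tangent p v -> tangent p w ->
    g p v w = g p w v;
  metric_pos : forall p (v : tvec M), tangent p v -> v <> 0 -> 0 < g p v v;
  metric_smooth : forall X Y : M -> tvec M, vfield X -> vfield Y ->
    smooth (fun p => g p (X p) (Y p)) }.

(* [nabla p v V] is the covariant derivative at p, in the direction of
   v in T_pM, of the section V of phi^{-1}TN.  For phi := id this is an affine
   connection on M. *)
Record connection_along (R : realType) (m n : nat) (M : smoothManifold R m)
    (N : smoothManifold R n) (phi : M -> N)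
    (nabla : M -> tvec M -> (M -> tvec N) -> tvec N) : Prop := ConnectionAlong {
  connection_linear : forall p (c : R) (v w : tvec M) (V : M -> tvec N),
    tangent p v -> tangent p w -> field_along phi V ->
    nabla p (c *: v + w) V = c *: nabla p v V + nabla p w V;
  connection_add : forall p (v : tvec M) (V W : M -> tvec N),
    tangent p v -> field_along phi V -> field_along phi W ->
    nabla p v (fun q => V q + W q) = nabla p v V + nabla p v W;
  connection_leibniz : forall p (v : tvec M) (a : M -> R) (V : M -> tvec N),
    tangent p v -> smooth a -> field_along phi V ->
    nabla p v (fun q => a q *: V q) = v a *: V p + a p *: nabla p v V;
  connection_tangent : forall p (v : tvec M) (V : M -> tvec N),
    tangent p v -> field_along phi V -> tangent (phi p) (nabla p v V);
  connection_smooth : forall (X : M -> tvec M) (V : M -> tvec N),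
    vfield X -> field_along phi V ->
    field_along phi (fun p => nabla p (X p) V) }.

Record levi_civita (R : realType) (n : nat) (M : smoothManifold R n)
    (g : M -> tvec M -> tvec M -> R)
    (nabla : M -> tvec M -> (M -> tvec M) -> tvec M) : Prop := LeviCivita {
  levi_civita_connection : connection_along id nabla;
  levi_civita_torsion_free : forall X Y : M -> tvec M, vfield X -> vfield Y ->
    forall p, nabla p (X p) Y - nabla p (Y p) X = bracket X Y p;
  levi_civita_metric : forall X Y Z : M -> tvec M,
    vfield X -> vfield Y -> vfield Z -> forall p,
    X p (fun q => g q (Y q) (Z q)) =
    g p (nabla p (X p) Y) (Z p) + g p (Y p) (nabla p (X p) Z) }.

(* nabla^phi is the connection on phi^{-1}TN induced by nabla^N. *)
Record pullback_connection (R : realType) (m n : nat) (M : smoothManifold R m)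
    (N : smoothManifold R n) (phi : M -> N)
    (nablaN : N -> tvec N -> (N -> tvec N) -> tvec N)
    (nablaphi : M -> tvec M -> (M -> tvec N) -> tvec N) : Prop :=
  PullbackConnection {
  pullback_connection_along : connection_along phi nablaphi;
  pullback_connectionE : forall p (v : tvec M) (Y : N -> tvec N),
    tangent p v -> vfield Y ->
    nablaphi p v (fun q => Y (phi q)) = nablaN (phi p) (dmap phi v) Y }.

Definition orthonormal_at (R : realType) (n : nat) (M : smoothManifold R n)
    (g : M -> tvec M -> tvec M -> R) (p : M) (e : 'I_n -> tvec M) : Prop :=
  forall i j, g p (e i) (e j) = (i == j)%:R.

Record orthonormal_frame (R : realType) (n : nat) (M : smoothManifold R n)
    (g : M -> tvec M -> tvec M -> R) (e : 'I_n -> M -> tvec M) : Prop :=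
  OrthonormalFrame {
  frame_vfield : forall i, vfield (e i);
  frame_span : forall p (v : tvec M), tangent p v ->
    exists c : 'I_n -> R, v = \sum_i c i *: e i p;
  frame_orthonormal : forall p, orthonormal_at g p (fun i => e i p) }.

(* Trace_g of a C^oo(M)-bilinear B at p: \sum_i B (E_i, E_i) (p), for vector
   fields E_i whose values at p form an orthonormal basis of T_pM. *)
Definition trace_g (R : realType) (n : nat) (M : smoothManifold R n)
    (g : M -> tvec M -> tvec M -> R) (V : lmodType R)
    (B : (M -> tvec M) -> (M -> tvec M) -> M -> V) (p : M) : V :=
  let E := xget (fun _ _ _ => 0)
    [set E : 'I_n -> M -> tvec M |
      (forall i, vfield (E i)) /\ orthonormal_at g p (fun i => E i p)] in
  \sum_i B (E i) (E i) p.

Definition grad (R : realType) (n : nat) (M : smoothManifold R n)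
    (g : M -> tvec M -> tvec M -> R) (a : M -> R) : M -> tvec M :=
  fun p => xget (fun _ => 0)
    [set v : tvec M | tangent p v /\
      forall w : tvec M, tangent p w -> g p v w = w a].

Definition divergence (R : realType) (n : nat) (M : smoothManifold R n)
    (g : M -> tvec M -> tvec M -> R)
    (nabla : M -> tvec M -> (M -> tvec M) -> tvec M)
    (X : M -> tvec M) : M -> R :=
  trace_g g (V := R^o) (fun Y Z p => g p (nabla p (Y p) X) (Z p)).

Definition laplacian (R : realType) (n : nat) (M : smoothManifold R n)
    (g : M -> tvec M -> tvec M -> R)
    (nabla : M -> tvec M -> (M -> tvec M) -> tvec M)
    (a : M -> R) : M -> R :=
  divergence g nabla (grad g a).

Definition extension (R : realType) (n : nat) (M : smoothManifold R n)
    (p : M) (v : tvec M) : M -> tvec M :=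
  xget (fun _ _ => 0) [set X : M -> tvec M | vfield X /\ X p = v].

(* R(u, v)w at p, where R(X, Y)Z = [nabla_X, nabla_Y]Z - nabla_[X, Y]Z. *)
Definition curvature (R : realType) (n : nat) (M : smoothManifold R n)
    (nabla : M -> tvec M -> (M -> tvec M) -> tvec M)
    (p : M) (u v w : tvec M) : tvec M :=
  let X := extension p u in
  let Y := extension p v in
  let Z := extension p w in
  nabla p (X p) (fun q => nabla q (Y q) Z)
  - nabla p (Y p) (fun q => nabla q (X q) Z)
  - nabla p (bracket X Y p) Z.

(* R(X, Y, Z, W) = g(R(Z, W)Y, X), the sign convention for which R_1212 is the
   Gauss curvature of a surface (positive on round spheres). *)
Definition riemann4 (R : realType) (n : nat) (M : smoothManifold R n)
    (g : M -> tvec M -> tvec M -> R)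
    (nabla : M -> tvec M -> (M -> tvec M) -> tvec M)
    (p : M) (x y z w : tvec M) : R :=
  g p (curvature nabla p z w y) x.

Definition tension (R : realType) (m n : nat) (M : smoothManifold R m)
    (N : smoothManifold R n) (g : M -> tvec M -> tvec M -> R)
    (nablaM : M -> tvec M -> (M -> tvec M) -> tvec M)
    (phi : M -> N) (nablaphi : M -> tvec M -> (M -> tvec N) -> tvec N) :
    M -> tvec N :=
  trace_g g (fun X Y p =>
    nablaphi p (X p) (fun q => dmap phi (Y q)) - dmap phi (nablaM p (X p) Y)).

Definition bitension (R : realType) (m n : nat) (M : smoothManifold R m)
    (N : smoothManifold R n) (g : M -> tvec M -> tvec M -> R)
    (nablaM : M -> tvec M -> (M -> tvec M) -> tvec M)
    (nablaN : N -> tvec N -> (N -> tvec N) -> tvec N)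
    (phi : M -> N) (nablaphi : M -> tvec M -> (M -> tvec N) -> tvec N) :
    M -> tvec N :=
  let tau := tension g nablaM phi nablaphi in fun p =>
  trace_g g (fun X Y q =>
    nablaphi q (X q) (fun r => nablaphi r (Y r) tau)
    - nablaphi q (nablaM q (X q) Y) tau) p
  - trace_g g (fun X Y q =>
    curvature nablaN (phi q) (dmap phi (X q)) (tau q) (dmap phi (Y q))) p.

Definition f_biharmonic (R : realType) (m n : nat) (M : smoothManifold R m)
    (N : smoothManifold R n) (g : M -> tvec M -> tvec M -> R)
    (nablaM : M -> tvec M -> (M -> tvec M) -> tvec M)
    (nablaN : N -> tvec N -> (N -> tvec N) -> tvec N)
    (phi : M -> N) (nablaphi : M -> tvec M -> (M -> tvec N) -> tvec N)
    (f : M -> R) : Prop :=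
  let tau := tension g nablaM phi nablaphi in
  let tau2 := bitension g nablaM nablaN phi nablaphi in
  forall p, f p *: tau2 p + laplacian g nablaM f p *: tau p
    + 2 *: nablaphi p (grad g f p) tau = 0.

Definition vertical (R : realType) (m n : nat) (M : smoothManifold R m)
    (N : smoothManifold R n) (phi : M -> N) (p : M) (v : tvec M) : Prop :=
  tangent p v /\ dmap phi v = 0.

Definition horizontal (R : realType) (m n : nat) (M : smoothManifold R m)
    (N : smoothManifold R n) (g : M -> tvec M -> tvec M -> R) (phi : M -> N)
    (p : M) (v : tvec M) : Prop :=
  tangent p v /\ forall w, vertical phi p w -> g p v w = 0.

Record riemannian_submersion (R : realType) (m n : nat)
    (M : smoothManifold R m) (N : smoothManifold R n)
    (g : M -> tvec M -> tvec M -> R) (h : N -> tvec N -> tvec N -> R)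
    (phi : M -> N) : Prop := RiemannianSubmersion {
  submersion_smooth : smooth_map phi;
  submersion_surj : forall p (w : tvec N), tangent (phi p) w ->
    exists2 v : tvec M, tangent p v & dmap phi v = w;
  submersion_isometry : forall p (v w : tvec M),
    horizontal g phi p v -> horizontal g phi p w ->
    h (phi p) (dmap phi v) (dmap phi w) = g p v w }.

Record adapted_frame (R : realType) (M : smoothManifold R 3)
    (N : smoothManifold R 2)
    (g : M -> tvec M -> tvec M -> R) (h : N -> tvec N -> tvec N -> R)
    (phi : M -> N) (e1 e2 e3 : M -> tvec M) (eps1 eps2 : N -> tvec N) : Prop :=
  AdaptedFrame {
  adapted_frameM : orthonormal_frame g (tnth [tuple e1; e2; e3]);
  adapted_frameN : orthonormal_frame h (tnth [tuple eps1; eps2]);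
  adapted_vertical : forall p, vertical phi p (e3 p);
  adapted_horizontal : forall p,
    horizontal g phi p (e1 p) /\ horizontal g phi p (e2 p);
  adapted_basic : forall p,
    dmap phi (e1 p) = eps1 (phi p) /\ dmap phi (e2 p) = eps2 (phi p) }.

Record integrability_data (R : realType) (M : smoothManifold R 3)
    (e1 e2 e3 : M -> tvec M) (f1 f2 kappa1 kappa2 sigma : M -> R) : Prop :=
  IntegrabilityData {
  data_smooth : [/\ smooth f1, smooth f2, smooth kappa1, smooth kappa2
                  & smooth sigma];
  data_bracket13 : forall p, bracket e1 e3 p = kappa1 p *: e3 p;
  data_bracket23 : forall p, bracket e2 e3 p = kappa2 p *: e3 p;
  data_bracket12 : forall p, bracket e1 e2 p =
    f1 p *: e1 p + f2 p *: e2 p - (2 * sigma p) *: e3 p }.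

(* Main.v *)
Require Import Defs.
From mathcomp Require Import all_boot all_order all_algebra.
From mathcomp Require Import all_classical all_reals all_analysis.
From mathcomp Require Import ring lra.
Import numFieldNormedType.Exports.
Import Order.TTheory GRing.Theory Num.Theory.
Set Implicit Arguments.
Unset Strict Implicit.
Unset Printing Implicit Defensive.
Local Open Scope classical_set_scope.
Local Open Scope ring_scope.

(* Everything is expanded in the global frames.  A C^oo-linear expression in a
   vector field depends only on its value at the point, so every trace may be
   computed in the adapted frame, whatever local frame [trace_g] picks.
   Compatibility with the metric and torsion-freeness give
   nabla_{e_i} e_i = - \sum_j <[e_i, e_j], e_i> e_j, hence
     nabla_{e1} e1 = - f1 e2,  nabla_{e2} e2 = f2 e1,
     nabla_{e3} e3 = kappa1 e1 + kappa2 e2,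
   and, f1 and f2 being pulled back from N, nabla^pi_{e_i} eps1 = - f_i eps2 and
   nabla^pi_{e_i} eps2 = f_i eps1 with f_3 = 0.  So tau = - kappa1 eps1 - kappa2
   eps2.  Its rough Laplacian follows from these rules, the curvature term of
   the bitension field is K tau, and the Leibniz rule for the Laplacian gathers
   f tau_2 + (Delta f) tau + 2 nabla_{grad f} tau into the two components along
   eps1 and eps2. *)

(** * Functions of class C^k on open subsets of R^n *)

Lemma near_eq_differentiable (R : realType) (V W : normedModType R)
    (f g : V -> W) (x : V) :
  (\near x, f x = g x) -> differentiable f x -> differentiable g x.
Proof.
move=> fg df; have [cdf Df] := (diff_locallyP x f).1 df.
have fgx : f x = g x by exact: nbhs_singleton fg.
(* The first-order expansion of [f] at [x] is also one of [g], since the remainder estimate only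
   concerns points near 0; [diff_unique] then identifies the differential of [g]. *)
have Dg : g \o shift x = cst (g x) + 'd f x +o_ 0 id.
  apply/eqaddoP => eps eps0.
  have := (eqaddoP _ _ _ _).1 Df eps eps0.
  have fg0 : \forall y \near 0, f (shift x y) = g (shift x y).
    by move: fg; rewrite (near_shift 0) subr0.
  move: fg0; apply: filterS2 => y fgy.
  by rewrite !fctE /= -fgx; rewrite /= in fgy; rewrite fgy.
by apply/diff_locallyP; rewrite (diff_unique cdf Dg).
Qed.

(** Openness of [U] turns equality on [U] into equality near each of its points, which is all that
    continuity and derivatives depend on. This is what allows sum and product rules valid only on
    [U] to be used in inductions on [k]. *)
Lemma eq_Ck_on (R : realType) (n k : nat) (U : set 'rV[R]_n)
    (f g : 'rV[R]_n -> R) :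
  open U -> (forall x, U x -> f x = g x) -> Ck_on k U f -> Ck_on k U g.
Proof.
move=> oU; elim: k f g => [|k IH] f g fg /=.
  move=> cf x Ux; have nfg : \near x, f x = g x.
    by apply: filterS (open_nbhs_nbhs (conj oU Ux)).
  have cgx : g @ x --> g x.
    rewrite -(fg x Ux); apply: cvg_trans (cf x Ux).
    exact: near_eq_cvg nfg.
  exact: cgx.
have nfg x : U x -> \near x, f x = g x.
  by move=> Ux; apply: filterS (open_nbhs_nbhs (conj oU Ux)).
move=> [df Df]; split=> [x Ux|v].
  exact: near_eq_differentiable (nfg x Ux) (df x Ux).
by apply: IH (Df v) => x Ux; apply: near_eq_derive; exact: nfg.
Qed.

Lemma Ck_on_cst (R : realType) (n k : nat) (U : set 'rV[R]_n) (c : R) :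
  Ck_on k U (fun=> c).
Proof.
elim: k c => [|k IH] c /=; first by move=> x _; exact: cst_continuous.
split=> [x _|v]; first exact: differentiable_cst.
have -> : (fun x => 'D_v (fun=> c) x) = (fun=> 0).
  by apply: boolp.funext => x; exact: derive_cst.
exact: IH.
Qed.

Lemma Ck_onD (R : realType) (n k : nat) (U : set 'rV[R]_n)
    (f g : 'rV[R]_n -> R) :
  open U -> Ck_on k U f -> Ck_on k U g -> Ck_on k U (fun x => f x + g x).
Proof.
move=> oU; elim: k f g => [|k IH] f g /=.
  by move=> cf cg x Ux; apply: continuousD; [exact: cf | exact: cg].
move=> [df Df] [dg Dg]; split=> [x Ux|v].
  by apply: differentiableD; [exact: df | exact: dg].
apply: (eq_Ck_on oU) (IH _ _ (Df v) (Dg v)) => x Ux.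
by rewrite -deriveD//; apply: diff_derivable; [exact: df | exact: dg].
Qed.

Lemma smooth_on_derive (R : realType) (n : nat) (U : set 'rV[R]_n)
    (f : 'rV[R]_n -> R) (v : 'rV[R]_n) :
  smooth_on U f -> smooth_on U (fun x => 'D_v f x).
Proof. by move=> sf k; have [_] := sf k.+1; apply. Qed.

(** The product rule pairs a derivative of one factor with the other factor itself. Keeping both
    factors smooth, rather than C^k, makes the induction hypothesis apply to these two products. *)
Lemma smooth_onM (R : realType) (n : nat) (U : set 'rV[R]_n)
    (f g : 'rV[R]_n -> R) :
  open U -> smooth_on U f -> smooth_on U g -> smooth_on U (fun x => f x * g x).
Proof.
move=> oU + + k; elim: k f g => [|k IH] f g sf sg /=.
  by move=> x Ux; apply: continuousM; [exact: (sf 0%N) | exact: (sg 0%N)].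
have [df _] := sf 1%N; have [dg _] := sg 1%N.
split=> [x Ux|v]; first by apply: differentiableM; [exact: df | exact: dg].
have := Ck_onD oU (IH _ _ sf (smooth_on_derive v sg))
  (IH _ _ sg (smooth_on_derive v sf)).
apply: (eq_Ck_on oU) => x Ux.
by rewrite -deriveM//; apply: diff_derivable; [exact: df | exact: dg].
Qed.

(** * The algebra of smooth functions on a manifold *)

Section SmoothFunctions.
Variables (R : realType) (n : nat) (M : smoothManifold R n).
Implicit Types (a b : M -> R) (p : M).

Lemma smooth_cst (r : R) : smooth (fun _ : M => r).
Proof. by move=> c _ k; exact: Ck_on_cst. Qed.

Lemma smoothD a b : smooth a -> smooth b -> smooth (fun p => a p + b p).
Proof.
move=> sa sb c Mc k.
exact: Ck_onD (@chart_img_open _ _ _ c) (sa c Mc k) (sb c Mc k).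
Qed.

Lemma smoothM a b : smooth a -> smooth b -> smooth (fun p => a p * b p).
Proof.
by move=> sa sb c Mc; exact: smooth_onM (@chart_img_open _ _ _ c) (sa c Mc) (sb c Mc).
Qed.

Lemma smoothN a : smooth a -> smooth (fun p => - a p).
Proof.
move=> sa; rewrite (_ : (fun p => _) = fun p => -1 * a p).
  exact: smoothM (smooth_cst _) sa.
by apply/funext => p; rewrite mulN1r.
Qed.

Lemma smoothB a b : smooth a -> smooth b -> smooth (fun p => a p - b p).
Proof. by move=> sa sb; exact: smoothD sa (smoothN sb). Qed.

Lemma smooth_comb a b b' : smooth a -> smooth b -> smooth b' ->
  smooth (fun p => a p * b p + b' p).
Proof. by move=> sa sb sb'; exact: smoothD (smoothM sa sb) sb'. Qed.

End SmoothFunctions.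
Arguments smooth_cst [R n] M r.

(** * Tangent vectors as point derivations *)

Section TangentVectors.
Variables (R : realType) (n : nat) (M : smoothManifold R n).
Implicit Types (a b : M -> R) (p : M) (v w : tvec M) (X Y : M -> tvec M).

Lemma tangent0 p : tangent p (0 : tvec M).
Proof.
by split=> // [c a b _ _|a b _ _]; rewrite /GRing.zero /= ?(mulr0, mul0r, addr0).
Qed.

Lemma tangent_comb p (c : R) v w :
  tangent p v -> tangent p w -> tangent p (c *: v + w).
Proof.
move=> Tv Tw; split=> [a sa|r a b sa sb|a b sa sb].
- transitivity (c * v a + w a) => //.
  by rewrite (tangent_junk Tv) // (tangent_junk Tw) // mulr0 addr0.
- transitivity (c * v (fun q => r * a q + b q) + w (fun q => r * a q + b q)) => //.
  rewrite !(tangent_linear Tv, tangent_linear Tw) //.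
  transitivity (r * (c * v a + w a) + (c * v b + w b)) => //; ring.
- transitivity (c * v (fun q => a q * b q) + w (fun q => a q * b q)) => //.
  rewrite !(tangent_leibniz Tv, tangent_leibniz Tw) //.
  transitivity ((c * v a + w a) * b p + a p * (c * v b + w b)) => //; ring.
Qed.

Lemma tangentZ p (c : R) v : tangent p v -> tangent p (c *: v).
Proof. by move=> Tv; rewrite -[c *: v]addr0; exact: tangent_comb Tv (tangent0 p). Qed.

Lemma tangentD p v w : tangent p v -> tangent p w -> tangent p (v + w).
Proof. by rewrite -[v]scale1r => Tv; apply: tangent_comb; rewrite -[v]scale1r. Qed.

Lemma tangent_sum p (I : finType) (v : I -> tvec M) :
  (forall i, tangent p (v i)) -> tangent p (\sum_i v i).
Proof.
by move=> Tv; apply: big_rec => [|i w _]; [exact: tangent0 | exact: tangentD].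
Qed.

(** The Leibniz rule for 1 * 1 = 1 gives v 1 = 2 v 1, hence v 1 = 0; linearity does the rest. *)
Lemma tangent_cst p v (r : R) : tangent p v -> v (fun=> r) = 0.
Proof.
move=> Tv; have v1 : v (fun=> 1) = 0.
  have := tangent_leibniz Tv (smooth_cst M 1) (smooth_cst M 1).
  rewrite !mulr1 mul1r.
  by move/eqP; rewrite -subr_eq0 opprD addNKr oppr_eq0 => /eqP.
have v0 : v (fun=> 0) = 0.
  have := tangent_linear Tv 1 (smooth_cst M 0) (smooth_cst M 0).
  rewrite mulr0 addr0 mul1r.
  by move/eqP; rewrite -subr_eq0 opprD addNKr oppr_eq0 => /eqP.
have := tangent_linear Tv r (smooth_cst M 1) (smooth_cst M 0).
by rewrite v1 v0 mulr1 mulr0 !addr0.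
Qed.

Lemma tangentDfun p v a b : tangent p v -> smooth a -> smooth b ->
  v (fun q => a q + b q) = v a + v b.
Proof.
move=> Tv sa sb; rewrite -[v a]mul1r -(tangent_linear Tv) //.
by congr v; apply/boolp.funext => q; rewrite mul1r.
Qed.

Lemma tangentNfun p v a : tangent p v -> smooth a ->
  v (fun q => - a q) = - v a.
Proof.
move=> Tv sa; rewrite -[- v a]addr0 -mulN1r -(tangent_cst 0 Tv).
rewrite -(tangent_linear Tv) //; last exact: (smooth_cst M 0).
by congr v; apply/boolp.funext => q; rewrite mulN1r addr0.
Qed.

Lemma tangentBfun p v a b : tangent p v -> smooth a -> smooth b ->
  v (fun q => a q - b q) = v a - v b.
Proof.
move=> Tv sa sb; rewrite (tangentDfun Tv) ?(tangentNfun Tv) //.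
exact: smoothN.
Qed.

End TangentVectors.

(** * Sections of the pullback bundle as a module over the smooth functions *)

Section FieldsAlong.
Variables (R : realType) (m n : nat).
Variables (M : smoothManifold R m) (N : smoothManifold R n) (phi : M -> N).
Implicit Types (a : M -> R) (p : M) (V W : M -> tvec N).

Lemma field_along0 : field_along phi (fun=> 0).
Proof. by split=> [p|b sb]; [exact: tangent0 | exact: smooth_cst]. Qed.

Lemma field_along_comb a V W : smooth a ->
  field_along phi V -> field_along phi W ->
  field_along phi (fun q => a q *: V q + W q).
Proof.
move=> sa [TV sV] [TW sW]; split=> [p|b sb]; first exact: tangent_comb.
exact: smooth_comb sa (sV b sb) (sW b sb).
Qed.

Lemma field_alongZ a V : smooth a -> field_along phi V ->
  field_along phi (fun q => a q *: V q).
Proof.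
move=> sa fV; rewrite (_ : (fun q => _) = fun q => a q *: V q + 0).
  exact: field_along_comb sa fV field_along0.
by apply/boolp.funext => q; rewrite addr0.
Qed.

Lemma field_alongD V W : field_along phi V -> field_along phi W ->
  field_along phi (fun q => V q + W q).
Proof.
move=> fV fW; rewrite (_ : (fun q => _) = fun q => 1 *: V q + W q).
  exact: field_along_comb (smooth_cst M 1) fV fW.
by apply/boolp.funext => q; rewrite scale1r.
Qed.

Lemma field_along_sum (I : finType) (V : I -> M -> tvec N) :
  (forall i, field_along phi (V i)) ->
  field_along phi (fun q => \sum_i V i q).
Proof.
move=> fV; rewrite (_ : (fun q => _) = \sum_i V i); last first.
  by apply/boolp.funext => q; rewrite [in RHS]fct_sumE.
apply: big_rec => [|i W _ fW]; first exact: field_along0.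
exact: field_alongD.
Qed.

Lemma field_tangent V p : field_along phi V -> tangent (phi p) (V p).
Proof. by move=> [TV _]; exact: TV. Qed.

End FieldsAlong.

(** * The Lie bracket of vector fields *)

Section Brackets.
Variables (R : realType) (n : nat) (M : smoothManifold R n).
Implicit Types (a b : M -> R) (p : M) (v w : tvec M) (X Y : M -> tvec M).

Lemma vfield_tangent X p : vfield X -> tangent p (X p).
Proof. by move=> [TX _]; exact: TX. Qed.

Lemma vfield_smooth X b : vfield X -> smooth b -> smooth (fun p => X p b).
Proof. by move=> [_]; apply. Qed.

(** In the Leibniz rule the mixed products X a * Y b + Y a * X b are symmetric in [X] and [Y], so
    they cancel in the commutator. On a non-smooth function both terms of the bracket are
    derivatives of the constant 0. *)
Lemma vfield_bracket X Y : vfield X -> vfield Y -> vfield (bracket X Y).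
Proof.
move=> vX vY; have TX p := vfield_tangent p vX; have TY p := vfield_tangent p vY.
split=> [p|b sb]; last first.
  by apply: smoothB; apply: vfield_smooth => //; exact: vfield_smooth.
have junk Z b : vfield Z -> ~ smooth b -> (fun q => Z q b) = fun=> 0.
  by move=> vZ sb; apply/boolp.funext => q;
    rewrite (tangent_junk (vfield_tangent q vZ)).
split=> [b sb|c a b sa sb|a b sa sb].
- by rewrite /bracket !junk // (tangent_cst _ (TX p)) (tangent_cst _ (TY p)) subr0.
- rewrite /bracket.
  have lin Z : vfield Z -> (fun q => Z q (fun r => c * a r + b r)) =
      fun q => c * Z q a + Z q b.
    move=> vZ; apply/boolp.funext => q.
    by rewrite (tangent_linear (vfield_tangent q vZ)).
  rewrite !lin // !(tangent_linear (TX p), tangent_linear (TY p)) //;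
    try exact: vfield_smooth; ring.
- rewrite /bracket.
  have leib Z : vfield Z -> (fun q => Z q (fun r => a r * b r)) =
      fun q => Z q a * b q + a q * Z q b.
    move=> vZ; apply/boolp.funext => q.
    by rewrite (tangent_leibniz (vfield_tangent q vZ)).
  have sX c : smooth c -> smooth (fun q => X q c) by exact: vfield_smooth.
  have sY c : smooth c -> smooth (fun q => Y q c) by exact: vfield_smooth.
  rewrite !leib // (tangentDfun (TX p)) ?(tangentDfun (TY p));
    do ?[exact: smoothM | apply: smoothM => //; exact: sX
        | apply: smoothM => //; exact: sY].
  rewrite !(tangent_leibniz (TX p), tangent_leibniz (TY p)) //;
    do ?[exact: sX | exact: sY].
  ring.
Qed.

Lemma bracket_anti X Y p : bracket Y X p = - bracket X Y p.
Proof. by apply/boolp.funext => a; rewrite /bracket [RHS]opprB. Qed.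

Lemma bracket_comb a X Y Z p : smooth a -> vfield X -> vfield Y -> vfield Z ->
  bracket (fun q => a q *: X q + Y q) Z p =
  a p *: bracket X Z p - Z p a *: X p + bracket Y Z p.
Proof.
move=> sa vX vY vZ; apply/boolp.funext => b; have TZ := vfield_tangent p vZ.
(* Tangent vectors are functionals on all functions; on a non-smooth [b] every term vanishes by
   convention. *)
have [sb|nsb] := boolp.pselect (smooth b); last first.
  have vW : vfield (fun q => a q *: X q + Y q) by exact: field_along_comb.
  rewrite (tangent_junk (vfield_tangent p (vfield_bracket vW vZ))) //.
  transitivity (a p * bracket X Z p b - Z p a * X p b + bracket Y Z p b) => //.
  rewrite (tangent_junk (vfield_tangent p (vfield_bracket vX vZ))) //.
  rewrite (tangent_junk (vfield_tangent p (vfield_bracket vY vZ))) //.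
  by rewrite (tangent_junk (vfield_tangent p vX)) // !mulr0 subrr addr0.
have sX := vfield_smooth vX sb; have sY := vfield_smooth vY sb.
transitivity (a p * X p (fun q => Z q b) + Y p (fun q => Z q b)
  - Z p (fun q => a q * X q b + Y q b)) => //.
rewrite (tangentDfun TZ) ?(tangent_leibniz TZ) //; last exact: smoothM.
transitivity (a p * (X p (fun q => Z q b) - Z p (fun q => X q b))
  - Z p a * X p b + (Y p (fun q => Z q b) - Z p (fun q => Y q b))) => //.
ring.
Qed.

End Brackets.

(** * Bilinearity of the metric on tangent vectors *)

Section Metric.
Variables (R : realType) (n : nat) (M : smoothManifold R n).
Variables (g : M -> tvec M -> tvec M -> R) (hg : riemannian_metric g).
Implicit Types (p : M) (u v w : tvec M).

Lemma metric0l p w : tangent p w -> g p 0 w = 0.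
Proof.
move=> Tw; have := metric_linear hg 1 (tangent0 p) (tangent0 p) Tw.
rewrite scaler0 addr0 mul1r => /eqP.
by rewrite -subr_eq0 opprD addNKr oppr_eq0 => /eqP.
Qed.

Lemma metricZl p (c : R) v w : tangent p v -> tangent p w ->
  g p (c *: v) w = c * g p v w.
Proof.
move=> Tv Tw; rewrite -[c *: v]addr0 (metric_linear hg) ?metric0l ?addr0 //.
exact: tangent0.
Qed.

Lemma metricDl p u v w : tangent p u -> tangent p v -> tangent p w ->
  g p (u + v) w = g p u w + g p v w.
Proof.
by move=> Tu Tv Tw; rewrite -[u]scale1r (metric_linear hg) // mul1r scale1r.
Qed.

Lemma metricBl p u v w : tangent p u -> tangent p v -> tangent p w ->
  g p (u - v) w = g p u w - g p v w.
Proof.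
by move=> Tu Tv Tw; rewrite addrC -scaleN1r (metric_linear hg) // mulN1r addrC.
Qed.

Lemma metric_suml p (I : finType) (v : I -> tvec M) w :
  (forall i, tangent p (v i)) -> tangent p w ->
  g p (\sum_i v i) w = \sum_i g p (v i) w.
Proof.
move=> Tv Tw.
(* Additivity of [g] holds on tangent vectors only, so tangency of the partial sums is carried
   through the induction. *)
suff [] : tangent p (\sum_i v i) /\ g p (\sum_i v i) w = \sum_i g p (v i) w by [].
elim/big_ind2: _ => [|u r u' r' [Tu <-] [Tu' <-]|i _].
- by split; [exact: tangent0 | exact: metric0l].
- by split; [exact: tangentD | exact: metricDl].
- by split.
Qed.

End Metric.

(** * Orthonormal frames: coefficients, traces and gradients *)

Section Frame.
Variables (R : realType) (n : nat) (M : smoothManifold R n).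
Variables (g : M -> tvec M -> tvec M -> R) (hg : riemannian_metric g).
Variables (e : 'I_n -> M -> tvec M) (he : orthonormal_frame g e).
Implicit Types (a b : M -> R) (p : M) (u v w : tvec M) (X Y : M -> tvec M).

Let ve i : vfield (e i). Proof. exact: frame_vfield he i. Qed.
Let Te i p : tangent p (e i p). Proof. exact: vfield_tangent p (ve i). Qed.

(** Some coefficients exist by [frame_span]; pairing with [e i p] identifies them. *)
Lemma frame_coef p v : tangent p v -> v = \sum_i g p v (e i p) *: e i p.
Proof.
move=> Tv; have [c vE] := frame_span he Tv; rewrite {1}vE.
apply: eq_bigr => i _; congr (_ *: _); rewrite vE (metric_suml hg) //; last first.
  by move=> j; exact: tangentZ.
rewrite (bigD1 i) //= (metricZl hg) // (frame_orthonormal he) eqxx mulr1.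
rewrite big1 ?addr0 // => j ji.
by rewrite (metricZl hg) // (frame_orthonormal he) (negbTE ji) mulr0.
Qed.

Lemma frame_metric p u v : tangent p u -> tangent p v ->
  g p u v = \sum_i g p u (e i p) * g p v (e i p).
Proof.
move=> Tu Tv; rewrite {1}(frame_coef Tu) (metric_suml hg) //; last first.
  by move=> i; exact: tangentZ.
apply: eq_bigr => i _; rewrite (metricZl hg) //; congr (_ * _).
by rewrite (Defs.metric_sym hg).
Qed.

(** C^oo(M)-linearity of a map whose values are taken at the point [p]; additivity and homogeneity
    are packed into a single identity. *)
Definition tensorial p (V : lmodType R) (T : (M -> tvec M) -> V) :=
  forall a X Y, smooth a -> vfield X -> vfield Y ->
    T (fun q => a q *: X q + Y q) = a p *: T X + T Y.

(** The frame is global, so [X] is a combination of the [e i] with coefficients smooth on all of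
    [M], and linearity applies to it. In particular [T X] depends on [X] only through [X p]. *)
Lemma tensorial_frame p (V : lmodType R) (T : (M -> tvec M) -> V) X :
  tensorial p T -> vfield X -> T X = \sum_i g p (X p) (e i p) *: T (e i).
Proof.
move=> lT vX.
have XE : X = \sum_i (fun q => g q (X q) (e i q) *: e i q).
  apply/boolp.funext => q; rewrite fct_sumE; apply: frame_coef.
  exact: vfield_tangent q vX.
have T0 : T (fun=> 0) = 0.
  have := lT _ _ _ (smooth_cst M (-1)) (field_along0 id) (field_along0 id).
  rewrite scaler0 addr0 => ->; rewrite scaleN1r addNr //.
rewrite {1}XE.
(* Each use of [tensorial] requires the remaining partial sum to be a vector field, so both facts
   are proved together. *)
suff [] : vfield (\sum_i (fun q => g q (X q) (e i q) *: e i q)) /\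
  T (\sum_i (fun q => g q (X q) (e i q) *: e i q)) =
  \sum_i g p (X p) (e i p) *: T (e i) by [].
elim/big_rec2: _ => [|i W y _ [vY <-]]; first by split; [exact: field_along0|].
have sc : smooth (fun q => g q (X q) (e i q)) by exact: (metric_smooth hg).
split; first exact: (field_along_comb sc (ve i) vY).
exact: (lT _ _ _ sc (ve i) vY).
Qed.

(** The matrix [C] from the chosen frame [E] to [e] is orthogonal at [p]. Expanding [B] in both
    slots produces the entries of C^T C, so only the diagonal terms B(e_j, e_j) remain. *)
Lemma trace_gE (V : lmodType R)
    (B : (M -> tvec M) -> (M -> tvec M) -> M -> V) p :
  (forall Y, vfield Y -> tensorial p (fun X => B X Y p)) ->
  (forall X, vfield X -> tensorial p (fun Y => B X Y p)) ->
  trace_g g B p = \sum_i B (e i) (e i) p.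
Proof.
move=> lB rB; rewrite /trace_g.
set P := [set E : 'I_n -> M -> tvec M | _].
(* The frame [e] witnesses that the choice in [trace_g] is made from a nonempty set, so the default
   value does not occur. *)
have [vE oE] : P (xget (fun _ _ _ => 0) P).
  by apply: (@xgetI _ _ _ e); split=> //; exact: frame_orthonormal.
move: (xget _ P) vE oE => E vE oE; rewrite /P {P} /=.
have TE i : tangent p (E i p) by exact: vfield_tangent p (vE i).
pose C : 'M[R]_n := \matrix_(i, j) g p (E i p) (e j p).
have CCt : C *m C^T = 1%:M.
  apply/matrixP => i j; rewrite !mxE -(oE i j) (frame_metric (TE i) (TE j)).
  by apply: eq_bigr => k _; rewrite !mxE.
(* For a square matrix, C C^T = 1 implies C^T C = 1. *)
have CtC j k : \sum_i C i j * C i k = (j == k)%:R.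
  have /matrixP/(_ j k) := mulmx1C CCt; rewrite !mxE => <-.
  by apply: eq_bigr => i _; rewrite !mxE.
transitivity (\sum_i \sum_j \sum_k (C i j * C i k) *: B (e j) (e k) p).
  apply: eq_bigr => i _.
  rewrite (tensorial_frame (lB _ (vE i)) (vE i)); apply: eq_bigr => j _.
  rewrite (tensorial_frame (rB _ (ve j)) (vE i)) scaler_sumr.
  by apply: eq_bigr => k _; rewrite scalerA !mxE.
rewrite exchange_big; apply: eq_bigr => j _ /=.
rewrite exchange_big (bigD1 j) //= [X in _ + X]big1 ?addr0 => [|k kj].
  by rewrite -scaler_suml CtC eqxx scale1r.
by rewrite -scaler_suml CtC eq_sym (negbTE kj) scale0r.
Qed.

Lemma grad_spec a p : smooth a -> tangent p (grad g a p) /\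
  forall w, tangent p w -> g p (grad g a p) w = w a.
Proof.
move=> sa; rewrite /grad; set P := [set v : tvec M | _].
suff : P (xget (fun=> 0) P) by [].
(* The Riesz representative of w -> w a, written in the frame. *)
apply: (@xgetI _ _ _ (\sum_i e i p a *: e i p)); split=> [|w Tw].
  by apply: tangent_sum => i; exact: tangentZ.
rewrite (metric_suml hg) //; last by move=> i; exact: tangentZ.
rewrite [in RHS](frame_coef Tw) fct_sumE; apply: eq_bigr => i _.
by rewrite (metricZl hg) // (Defs.metric_sym hg) // mulrC.
Qed.

Lemma gradE a : smooth a -> grad g a = fun p => \sum_i e i p a *: e i p.
Proof.
move=> sa; apply/boolp.funext => p; have [Tg gE] := grad_spec p sa.
by rewrite {1}(frame_coef Tg); apply: eq_bigr => i _; rewrite gE.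
Qed.

Lemma vfield_grad a : smooth a -> vfield (grad g a).
Proof.
move=> sa; rewrite gradE //; apply: field_along_sum => i.
exact: field_alongZ (vfield_smooth (ve i) sa) (ve i).
Qed.

End Frame.

(** * Evaluation of tangent vectors on functions *)

Section TvecEvaluation.
Variables (R : realType) (n : nat) (M : smoothManifold R n).
Implicit Types (v w : tvec M) (b : M -> R).

Lemma tvecZ (c : R) v b : (c *: v) b = c * v b. Proof. by []. Qed.
Lemma tvecD v w b : (v + w) b = v b + w b. Proof. by []. Qed.
Lemma tvecN v b : (- v) b = - v b. Proof. by []. Qed.
Lemma tvec0 b : (0 : tvec M) b = 0. Proof. by []. Qed.
(** Evaluating on an arbitrary function with these rules turns an identity between tangent vectors
    into one between real numbers, within reach of [ring]. *)
Definition tvecE := (tvecZ, tvecD, tvecN, tvec0).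

End TvecEvaluation.

(** * Connections along a map *)

Section ConnectionAlong.
Variables (R : realType) (m n : nat).
Variables (M : smoothManifold R m) (N : smoothManifold R n) (phi : M -> N).
Variables (nabla : M -> tvec M -> (M -> tvec N) -> tvec N).
Hypothesis cn : connection_along phi nabla.
Implicit Types (a : M -> R) (p : M) (v w : tvec M) (V W : M -> tvec N).

Lemma nabla_comb p v a V W : tangent p v -> smooth a ->
  field_along phi V -> field_along phi W ->
  nabla p v (fun q => a q *: V q + W q) =
  v a *: V p + a p *: nabla p v V + nabla p v W.
Proof.
move=> Tv sa fV fW; rewrite (connection_add cn) //; last exact: field_alongZ.
by rewrite (connection_leibniz cn).
Qed.

Lemma nabla0l p V : field_along phi V -> nabla p 0 V = 0.
Proof.
move=> fV; have := connection_linear cn 1 (tangent0 p) (tangent0 p) fV.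
rewrite scaler0 addr0 scale1r => /eqP.
by rewrite -subr_eq0 opprD addNKr oppr_eq0 => /eqP.
Qed.

Lemma nablaZl p (c : R) v V : tangent p v -> field_along phi V ->
  nabla p (c *: v) V = c *: nabla p v V.
Proof.
move=> Tv fV; have := connection_linear cn c Tv (tangent0 p) fV.
by rewrite addr0 nabla0l // addr0.
Qed.

Lemma nablaDl p v w V : tangent p v -> tangent p w -> field_along phi V ->
  nabla p (v + w) V = nabla p v V + nabla p w V.
Proof.
by move=> Tv Tw fV; rewrite -[v]scale1r (connection_linear cn) // !scale1r.
Qed.

End ConnectionAlong.

(** * The curvature tensor of an affine connection *)

(** The curvature of three given fields, as opposed to [curvature], which takes vectors and chooses
    extensions; [curvatureE] reconciles the two. *)
Definition curvature_field (R : realType) (n : nat) (M : smoothManifold R n)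
    (nabla : M -> tvec M -> (M -> tvec M) -> tvec M)
    (X Y Z : M -> tvec M) (p : M) : tvec M :=
  nabla p (X p) (fun q => nabla q (Y q) Z)
  - nabla p (Y p) (fun q => nabla q (X q) Z)
  - nabla p (bracket X Y p) Z.

Section AffineConnection.
Variables (R : realType) (n : nat) (M : smoothManifold R n).
Variables (nabla : M -> tvec M -> (M -> tvec M) -> tvec M).
Hypothesis cn : connection_along id nabla.
Implicit Types (a : M -> R) (p : M) (X Y Z W : M -> tvec M).

Let nabla_vfield X Y : vfield X -> vfield Y ->
  vfield (fun p => nabla p (X p) Y).
Proof. by move=> vX vY; exact: (connection_smooth cn). Qed.

Lemma curvature_fieldN X Y Z p : vfield X -> vfield Y -> vfield Z ->
  curvature_field nabla Y X Z p = - curvature_field nabla X Y Z p.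
Proof.
move=> vX vY vZ; rewrite /curvature_field (bracket_anti X Y) -[- bracket X Y p]scaleN1r.
rewrite (nablaZl cn) //; last exact: vfield_tangent (vfield_bracket vX vY).
by apply/boolp.funext => b; rewrite !tvecE; ring.
Qed.

(** The term - Y(a) nabla_X Z coming from nabla_Y (a nabla_X Z) is cancelled by the term - Y(a) X of
    [a X, Y]. *)
Lemma curvature_field_tensorial1 Y Z p : vfield Y -> vfield Z ->
  tensorial p (fun X => curvature_field nabla X Y Z p).
Proof.
move=> vY vZ a X W sa vX vW; rewrite /curvature_field bracket_comb //.
have [TX TY TW] : [/\ tangent p (X p), tangent p (Y p) & tangent p (W p)].
  by split; exact: vfield_tangent.
rewrite (connection_linear cn) //; last exact: nabla_vfield.
rewrite [X in nabla p (Y p) X](_ : _ =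
    fun q => a q *: nabla q (X q) Z + nabla q (W q) Z); last first.
  apply/boolp.funext => q; rewrite (connection_linear cn) //;
    exact: vfield_tangent.
rewrite (nabla_comb cn) //; do ?exact: nabla_vfield.
have TXY : tangent p (bracket X Y p) by exact: vfield_tangent (vfield_bracket _ _).
have TWY : tangent p (bracket W Y p) by exact: vfield_tangent (vfield_bracket _ _).
move: (bracket X Y p) (bracket W Y p) TXY TWY => U U' TU TU'.
rewrite -scaleNr !(nablaDl cn) ?(nablaZl cn) //; do ?exact: tangentZ;
  do ?by apply: tangentD; exact: tangentZ.
by apply/boolp.funext => b; rewrite !tvecE; ring.
Qed.

Lemma curvature_field_tensorial2 X Z p : vfield X -> vfield Z ->
  tensorial p (fun Y => curvature_field nabla X Y Z p).
Proof.
move=> vX vZ a Y W sa vY vW.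
have vaYW : vfield (fun q => a q *: Y q + W q) by exact: field_along_comb.
rewrite !(@curvature_fieldN _ X) // (curvature_field_tensorial1 p vX vZ) //.
by rewrite opprD scalerN.
Qed.

(** The first derivatives of [a] cancel in pairs, and the coefficient X(Y a) - Y(X a) - [X, Y] a of
    [Z] vanishes by definition of the bracket. *)
Lemma curvature_field_tensorial3 X Y p : vfield X -> vfield Y ->
  tensorial p (fun Z => curvature_field nabla X Y Z p).
Proof.
move=> vX vY a Z W sa vZ vW; rewrite /curvature_field.
have [TX TY] : tangent p (X p) /\ tangent p (Y p).
  by split; exact: vfield_tangent.
have TXY : tangent p (bracket X Y p) by exact: vfield_tangent (vfield_bracket _ _).
have E U : vfield U -> (fun q => nabla q (U q) (fun r => a r *: Z r + W r)) =
    fun q => U q a *: Z q + (a q *: nabla q (U q) Z + nabla q (U q) W).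
  move=> vU; apply/boolp.funext => q; rewrite (nabla_comb cn) ?addrA //.
  exact: vfield_tangent.
rewrite !E //.
rewrite !(nabla_comb cn) //;
  do ?[exact: nabla_vfield | exact: vfield_smooth
      | by apply: field_along_comb => //; exact: nabla_vfield].
by rewrite {1}/bracket; apply/boolp.funext => b; rewrite !tvecE; ring.
Qed.

End AffineConnection.

Section FrameCurvature.
Variables (R : realType) (n : nat) (M : smoothManifold R n).
Variables (g : M -> tvec M -> tvec M -> R) (hg : riemannian_metric g).
Variables (e : 'I_n -> M -> tvec M) (he : orthonormal_frame g e).
Variables (nabla : M -> tvec M -> (M -> tvec M) -> tvec M).
Hypothesis cn : connection_along id nabla.
Implicit Types (p : M) (u v w : tvec M) (X Y Z : M -> tvec M).

Let ve i : vfield (e i). Proof. exact: frame_vfield he i. Qed.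

Lemma tensorial_eq p (V : lmodType R) (T : (M -> tvec M) -> V) X Y :
  tensorial p T -> vfield X -> vfield Y -> X p = Y p -> T X = T Y.
Proof.
move=> lT vX vY XYp; rewrite (tensorial_frame hg he lT vX).
by rewrite (tensorial_frame hg he lT vY) XYp.
Qed.

Lemma extension_spec p v : tangent p v ->
  vfield (extension p v) /\ extension p v p = v.
Proof.
move=> Tv; rewrite /extension; set P := [set X : M -> tvec M | _].
suff : P (xget (fun _ _ => 0) P) by [].
(* The extension with constant coefficients in the global frame shows that the set of extensions is
   nonempty. *)
apply: (@xgetI _ _ _ (fun q => \sum_i g p v (e i p) *: e i q)); split.
  apply: field_along_sum => i.
  exact: field_alongZ (smooth_cst M (g p v (e i p))) (ve i).
by rewrite -(frame_coef hg he Tv).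
Qed.

(** By tensoriality the chosen extensions are replaced by [X], [Y], [Z] one slot at a time. *)
Lemma curvatureE X Y Z p : vfield X -> vfield Y -> vfield Z ->
  curvature nabla p (X p) (Y p) (Z p) = curvature_field nabla X Y Z p.
Proof.
move=> vX vY vZ.
have [vX' X'p] := extension_spec (vfield_tangent p vX).
have [vY' Y'p] := extension_spec (vfield_tangent p vY).
have [vZ' Z'p] := extension_spec (vfield_tangent p vZ).
transitivity (curvature_field nabla (extension p (X p)) (extension p (Y p))
  (extension p (Z p)) p) => //.
rewrite (tensorial_eq (curvature_field_tensorial1 cn p vY' vZ') vX' vX X'p).
rewrite (tensorial_eq (curvature_field_tensorial2 cn p vX vZ') vY' vY Y'p).
exact: tensorial_eq (curvature_field_tensorial3 cn p vX vY) vZ' vZ Z'p.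
Qed.

(** Each vector is the value at [p] of its extension, and [c] is a constant smooth function, so this
    is an instance of tensoriality. The other slots are treated in the same way. *)
Lemma curvature_linear1 p (c : R) u u' v w :
  tangent p u -> tangent p u' -> tangent p v -> tangent p w ->
  curvature nabla p (c *: u + u') v w =
  c *: curvature nabla p u v w + curvature nabla p u' v w.
Proof.
move=> /(extension_spec)[+ <-] /(extension_spec)[+ <-].
move=> + + /(extension_spec)[+ <-] /(extension_spec)[+ <-].
move: (extension p u) (extension p u') (extension p v) (extension p w).
move=> U U' V W vU vU' vV vW; have sc := smooth_cst M c.
rewrite (curvatureE p (field_along_comb sc vU vU') vV vW).
by rewrite !curvatureE // (curvature_field_tensorial1 cn p vV vW).
Qed.

Lemma curvature_linear2 p (c : R) u v v' w :
  tangent p u -> tangent p v -> tangent p v' -> tangent p w ->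
  curvature nabla p u (c *: v + v') w =
  c *: curvature nabla p u v w + curvature nabla p u v' w.
Proof.
move=> /(extension_spec)[+ <-] /(extension_spec)[+ <-].
move=> + + /(extension_spec)[+ <-] /(extension_spec)[+ <-].
move: (extension p u) (extension p v) (extension p v') (extension p w).
move=> U V V' W vU vV vV' vW; have sc := smooth_cst M c.
rewrite (curvatureE p vU (field_along_comb sc vV vV') vW).
by rewrite !curvatureE // (curvature_field_tensorial2 cn p vU vW).
Qed.

Lemma curvature_linear3 p (c : R) u v w w' :
  tangent p u -> tangent p v -> tangent p w -> tangent p w' ->
  curvature nabla p u v (c *: w + w') =
  c *: curvature nabla p u v w + curvature nabla p u v w'.
Proof.
move=> /(extension_spec)[+ <-] /(extension_spec)[+ <-].
move=> + + /(extension_spec)[+ <-] /(extension_spec)[+ <-].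
move: (extension p u) (extension p v) (extension p w) (extension p w').
move=> U V W W' vU vV vW vW'; have sc := smooth_cst M c.
rewrite (curvatureE p vU vV (field_along_comb sc vW vW')).
by rewrite !curvatureE // (curvature_field_tensorial3 cn p vU vV).
Qed.

Lemma curvatureN p u v w : tangent p u -> tangent p v -> tangent p w ->
  curvature nabla p v u w = - curvature nabla p u v w.
Proof.
move=> /extension_spec[+ <-] /extension_spec[+ <-] /extension_spec[+ <-].
move: (extension p u) (extension p v) (extension p w) => U V W vU vV vW.
by rewrite !curvatureE // curvature_fieldN.
Qed.

Lemma curvature_same p u w : tangent p u -> tangent p w ->
  curvature nabla p u u w = 0.
Proof.
move=> Tu Tw; apply/boolp.funext => b.
have /(congr1 (fun T : tvec M => T b)) := curvatureN Tu Tu Tw.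
by rewrite !tvecE => /eqP; rewrite -addr_eq0 -mulr2n mulrn_eq0 => /eqP.
Qed.

Lemma curvature0l p v w : tangent p v -> tangent p w ->
  curvature nabla p 0 v w = 0.
Proof.
move=> Tv Tw; have := curvature_linear1 1 (tangent0 p) (tangent0 p) Tv Tw.
rewrite scaler0 addr0 scale1r => /eqP.
by rewrite -subr_eq0 opprD addNKr oppr_eq0 => /eqP.
Qed.

Lemma curvatureZ2 p (c : R) u v w :
  tangent p u -> tangent p v -> tangent p w ->
  curvature nabla p u (c *: v) w = c *: curvature nabla p u v w.
Proof.
move=> Tu Tv Tw; have T0 := tangent0 (M := M) p.
rewrite -[c *: v]addr0 curvature_linear2 // (curvatureN T0) // curvature0l //.
by rewrite oppr0 addr0.
Qed.

End FrameCurvature.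

(** * The Levi-Civita connection and the Laplacian in an orthonormal frame *)

Section FrameConnection.
Variables (R : realType) (n : nat) (M : smoothManifold R n).
Variables (g : M -> tvec M -> tvec M -> R) (hg : riemannian_metric g).
Variables (e : 'I_n -> M -> tvec M) (he : orthonormal_frame g e).
Variables (nabla : M -> tvec M -> (M -> tvec M) -> tvec M).
Hypothesis hnabla : levi_civita g nabla.
Implicit Types (a b : M -> R) (p : M) (u v w : tvec M) (X Y : M -> tvec M).

Let cn : connection_along id nabla. Proof. exact: levi_civita_connection hnabla. Qed.
Let ve i : vfield (e i). Proof. exact: frame_vfield he i. Qed.
Let Te i p : tangent p (e i p). Proof. exact: vfield_tangent p (ve i). Qed.
Let Tn X Y p : vfield X -> vfield Y -> tangent p (nabla p (X p) Y).
Proof. by move=> vX vY; exact: (vfield_tangent p (connection_smooth cn vX vY)). Qed.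

(** Differentiate the constant function <e_j, e_k> along e_i. *)
Lemma levi_civita_skew i j k p :
  g p (nabla p (e i p) (e j)) (e k p) = - g p (nabla p (e i p) (e k)) (e j p).
Proof.
have := levi_civita_metric hnabla (ve i) (ve j) (ve k) p.
rewrite [X in e i p X](_ : _ = fun=> (j == k)%:R); last first.
  by apply/boolp.funext => q; rewrite (frame_orthonormal he).
rewrite (tangent_cst _ (Te i p)) => /esym/eqP; rewrite addr_eq0 => /eqP ->.
by rewrite (Defs.metric_sym hg) //; exact: Tn.
Qed.

Lemma levi_civita_same i j p : g p (nabla p (e i p) (e j)) (e j p) = 0.
Proof. have := levi_civita_skew i j j p; lra. Qed.

(** By torsion-freeness the two sides differ by <nabla_{e_j} e_i, e_i>, which is 0 since e_i has
    unit length. *)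
Lemma levi_civita_bracket i j p :
  g p (nabla p (e i p) (e j)) (e i p) = g p (bracket (e i) (e j) p) (e i p).
Proof.
rewrite -(levi_civita_torsion_free hnabla) // (metricBl hg) //; do ?exact: Tn.
by rewrite levi_civita_same subr0.
Qed.

Lemma levi_civita_diag i p : nabla p (e i p) (e i) =
  \sum_j (- g p (bracket (e i) (e j) p) (e i p)) *: e j p.
Proof.
rewrite [LHS](frame_coef hg he (Tn p (ve i) (ve i))).
by apply: eq_bigr => j _; rewrite levi_civita_skew levi_civita_bracket.
Qed.

(** Differentiating <grad a, e_i> = e_i a along e_i gives <nabla_{e_i} grad a, e_i> = e_i(e_i a) -
    (nabla_{e_i} e_i) a. *)
Lemma laplacianE a p : smooth a -> laplacian g nabla a p =
  \sum_i (e i p (fun q => e i q a) - nabla p (e i p) (e i) a).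
Proof.
move=> sa; have vG := vfield_grad hg he sa.
rewrite /laplacian /divergence (trace_gE hg he).
- apply: eq_bigr => i _.
  have := levi_civita_metric hnabla (ve i) vG (ve i) p.
  rewrite [X in e i p X](_ : _ = fun q => e i q a); last first.
    by apply/boolp.funext => q; have [_ ->] := grad_spec hg he q sa.
  move=> ->; have [_ ->] := grad_spec hg he p sa; last exact: Tn.
  by rewrite addrK.
- move=> Y vY b X Z sb vX vZ.
  have [TX TZ TY] : [/\ tangent p (X p), tangent p (Z p) & tangent p (Y p)].
    by split; exact: vfield_tangent.
  rewrite (connection_linear cn) // (metric_linear hg) //; exact: Tn.
- move=> X vX b Y Z sb vY vZ.
  have [TX TZ TY] : [/\ tangent p (X p), tangent p (Z p) & tangent p (Y p)].
    by split; exact: vfield_tangent.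
  rewrite (Defs.metric_sym hg) ?(metric_linear hg) //; do ?exact: Tn.
    by congr (_ * _ + _); rewrite (Defs.metric_sym hg) //; exact: Tn.
  exact: tangent_comb.
Qed.

End FrameConnection.

Lemma sum_tnth2 (V : nmodType) (T : Type) (F : T -> V) (x y : T) :
  \sum_i F (tnth [tuple x; y] i) = F x + F y.
Proof. by rewrite !big_ord_recl big_ord0 addr0. Qed.

Lemma sum_tnth3 (V : nmodType) (T : Type) (F : T -> V) (x y z : T) :
  \sum_i F (tnth [tuple x; y; z] i) = F x + F y + F z.
Proof. by rewrite !big_ord_recl big_ord0 addr0 addrA. Qed.

(** * Connection and Gauss curvature of a surface in an orthonormal frame *)

Section SurfaceFrame.
Variables (R : realType) (N : smoothManifold R 2).
Variables (h : N -> tvec N -> tvec N -> R) (hh : riemannian_metric h).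
Variables (nabla : N -> tvec N -> (N -> tvec N) -> tvec N).
Hypothesis hnabla : levi_civita h nabla.
Variables (eps1 eps2 : N -> tvec N).
Hypothesis heps : orthonormal_frame h (tnth [tuple eps1; eps2]).
Implicit Type q : N.

Let i1 : 'I_2 := @Ordinal 2 0 isT.
Let i2 : 'I_2 := @Ordinal 2 1 isT.
Let cn : connection_along id nabla. Proof. exact: levi_civita_connection hnabla. Qed.

Lemma surface_frame_vfield : vfield eps1 /\ vfield eps2.
Proof. by split; [exact: frame_vfield heps i1 | exact: frame_vfield heps i2]. Qed.

Let v1 : vfield eps1. Proof. by case: surface_frame_vfield. Qed.
Let v2 : vfield eps2. Proof. by case: surface_frame_vfield. Qed.

Lemma surface_frame_orthonormal q :
  [/\ h q (eps1 q) (eps1 q) = 1, h q (eps1 q) (eps2 q) = 0,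
      h q (eps2 q) (eps1 q) = 0 & h q (eps2 q) (eps2 q) = 1].
Proof.
have on := frame_orthonormal heps q.
by split; [exact: on i1 i1 | exact: on i1 i2 | exact: on i2 i1 | exact: on i2 i2].
Qed.

Lemma surface_frame_coef q (v : tvec N) : tangent q v ->
  v = h q v (eps1 q) *: eps1 q + h q v (eps2 q) *: eps2 q.
Proof.
move=> Tv; rewrite {1}(frame_coef hh heps Tv).
exact: (sum_tnth2 (fun E => h q v (E q) *: E q)).
Qed.

(** Pairing with each frame vector isolates a coefficient. This later splits one vector equation
    into a system of two scalar ones. *)
Lemma surface_frame_free q (a b : R) :
  a *: eps1 q + b *: eps2 q = 0 -> a = 0 /\ b = 0.
Proof.
have [h11 h12 h21 h22] := surface_frame_orthonormal q.
have [T1 T2] : tangent q (eps1 q) /\ tangent q (eps2 q).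
  by split; exact: vfield_tangent.
move=> ab0; split.
  have : h q (a *: eps1 q + b *: eps2 q) (eps1 q) = 0 by rewrite ab0 (metric0l hh).
  rewrite (metric_linear hh) ?(metricZl hh) ?h11 ?h21 //; last exact: tangentZ.
  by rewrite mulr0 addr0 mulr1.
have : h q (a *: eps1 q + b *: eps2 q) (eps2 q) = 0 by rewrite ab0 (metric0l hh).
rewrite (metric_linear hh) ?(metricZl hh) ?h12 ?h22 //; last exact: tangentZ.
by rewrite mulr0 add0r mulr1.
Qed.

(** The structure functions of the frame: [eps1, eps2] = F1 eps1 + F2 eps2. *)
Let F1 q := h q (bracket eps1 eps2 q) (eps1 q).
Let F2 q := h q (bracket eps1 eps2 q) (eps2 q).
Let sF1 : smooth F1. Proof. exact: (metric_smooth hh (vfield_bracket v1 v2) v1). Qed.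
Let sF2 : smooth F2. Proof. exact: (metric_smooth hh (vfield_bracket v1 v2) v2). Qed.

(** In dimension two, metric compatibility leaves one unknown coefficient for each direction, and
    the bracket determines it. *)
Lemma surface_connection q :
  [/\ nabla q (eps1 q) eps1 = - F1 q *: eps2 q,
      nabla q (eps1 q) eps2 = F1 q *: eps1 q,
      nabla q (eps2 q) eps1 = - F2 q *: eps2 q &
      nabla q (eps2 q) eps2 = F2 q *: eps1 q].
Proof.
have Tn X Y : vfield X -> vfield Y -> tangent q (nabla q (X q) Y).
  by move=> vX vY; exact: (vfield_tangent q (connection_smooth cn vX vY)).
have skew i j k := levi_civita_skew hh heps hnabla i j k q.
have same i j := levi_civita_same hh heps hnabla i j q.
have brak i j := levi_civita_bracket hh heps hnabla i j q.
have h121 : h q (nabla q (eps1 q) eps2) (eps1 q) = F1 q by exact: brak i1 i2.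
have h212 : h q (nabla q (eps2 q) eps1) (eps2 q) = - F2 q.
  rewrite (brak i2 i1) (bracket_anti eps1 eps2) -scaleN1r (metricZl hh) ?mulN1r //;
    by apply: vfield_tangent => //; exact: vfield_bracket.
have h112 : h q (nabla q (eps1 q) eps1) (eps2 q) = - F1 q.
  by rewrite -h121; exact: skew i1 i1 i2.
have h221 : h q (nabla q (eps2 q) eps2) (eps1 q) = F2 q.
  by rewrite -[RHS]opprK -h212; exact: skew i2 i2 i1.
split.
- rewrite [LHS](surface_frame_coef (Tn _ _ v1 v1)) h112.
  by rewrite (same i1 i1 : h q (nabla q (eps1 q) eps1) (eps1 q) = 0) scale0r add0r.
- rewrite [LHS](surface_frame_coef (Tn _ _ v1 v2)) h121.
  by rewrite (same i1 i2 : h q (nabla q (eps1 q) eps2) (eps2 q) = 0) scale0r addr0.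
- rewrite [LHS](surface_frame_coef (Tn _ _ v2 v1)) h212.
  by rewrite (same i2 i1 : h q (nabla q (eps2 q) eps1) (eps1 q) = 0) scale0r add0r.
- rewrite [LHS](surface_frame_coef (Tn _ _ v2 v2)) h221.
  by rewrite (same i2 i2 : h q (nabla q (eps2 q) eps2) (eps2 q) = 0) scale0r addr0.
Qed.

(** The classical expression of the Gauss curvature through the structure functions of an
    orthonormal frame; [surface_curvature] relates it to the curvature tensor. *)
Definition gauss_curvature q :=
  eps1 q F2 - eps2 q F1 - F1 q ^+ 2 - F2 q ^+ 2.

Lemma surface_curvature q :
  curvature nabla q (eps1 q) (eps2 q) (eps1 q) = - gauss_curvature q *: eps2 q /\
  curvature nabla q (eps1 q) (eps2 q) (eps2 q) = gauss_curvature q *: eps1 q.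
Proof.
have [T1 T2] : tangent q (eps1 q) /\ tangent q (eps2 q).
  by split; exact: vfield_tangent.
have nablaZ v (a : N -> R) X : tangent q v -> smooth a -> vfield X ->
  nabla q v (fun r => a r *: X r) = v a *: X q + a q *: nabla q v X.
  by move=> Tv sa vX; rewrite (connection_leibniz cn).
have br : bracket eps1 eps2 q = F1 q *: eps1 q + F2 q *: eps2 q.
  by apply: surface_frame_coef; apply: vfield_tangent; exact: vfield_bracket.
have nbr X : vfield X -> nabla q (bracket eps1 eps2 q) X =
    F1 q *: nabla q (eps1 q) X + F2 q *: nabla q (eps2 q) X.
  move=> vX; rewrite br (connection_linear cn) ?(nablaZl cn) //.
  exact: tangentZ.
have [c11 c12 c21 c22] := surface_connection q.
rewrite !(curvatureE hh heps cn) // /curvature_field /gauss_curvature !nbr //.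
(* The first derivatives are rewritten as fields, not only at [q], because they are differentiated
   once more. *)
have -> : (fun r => nabla r (eps2 r) eps1) = fun r => - F2 r *: eps2 r.
  by apply/boolp.funext => r; have [] := surface_connection r.
have -> : (fun r => nabla r (eps1 r) eps1) = fun r => - F1 r *: eps2 r.
  by apply/boolp.funext => r; have [] := surface_connection r.
have -> : (fun r => nabla r (eps2 r) eps2) = fun r => F2 r *: eps1 r.
  by apply/boolp.funext => r; have [] := surface_connection r.
have -> : (fun r => nabla r (eps1 r) eps2) = fun r => F1 r *: eps1 r.
  by apply/boolp.funext => r; have [] := surface_connection r.
rewrite !nablaZ //; do ?exact: smoothN.
rewrite (tangentNfun T1) ?(tangentNfun T2) // c11 c12 c21 c22.
by split; apply/boolp.funext => b; rewrite !tvecE; ring.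
Qed.

End SurfaceFrame.

(** * The differential of a map *)

Section Differential.
Variables (R : realType) (m n : nat).
Variables (M : smoothManifold R m) (N : smoothManifold R n) (phi : M -> N).
Implicit Types (p : M) (v w : tvec M).

Lemma dmap_comb (c : R) v w :
  dmap phi (c *: v + w) = c *: dmap phi v + dmap phi w.
Proof.
apply/boolp.funext => b; rewrite !tvecE /dmap.
by case: ifP => _ //; rewrite mulr0 addr0.
Qed.

Lemma dmap0 : dmap phi 0 = 0.
Proof. by apply/boolp.funext => b; rewrite /dmap; case: ifP. Qed.

Lemma dmapZ (c : R) v : dmap phi (c *: v) = c *: dmap phi v.
Proof. by rewrite -[c *: v]addr0 dmap_comb dmap0 addr0. Qed.

Lemma dmapD v w : dmap phi (v + w) = dmap phi v + dmap phi w.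
Proof. by rewrite -{1}[v]scale1r dmap_comb scale1r. Qed.

Lemma dmap_sum (I : finType) (v : I -> tvec M) :
  dmap phi (\sum_i v i) = \sum_i dmap phi (v i).
Proof.
exact: (big_morph (dmap phi) dmapD dmap0).
Qed.

Lemma dmap_smooth v (b : N -> R) : smooth b ->
  dmap phi v b = v (fun p => b (phi p)).
Proof. by move=> sb; rewrite /dmap; case: ifP => // /negP[]; exact/boolp.asboolP. Qed.

End Differential.

(** * The submersion in its adapted frame: differential and structure functions *)

Section Submersion.
Variables (R : realType) (M : smoothManifold R 3) (N : smoothManifold R 2).
Variables (g : M -> tvec M -> tvec M -> R) (h : N -> tvec N -> tvec N -> R).
Variables (nablaM : M -> tvec M -> (M -> tvec M) -> tvec M).
Variables (nablaN : N -> tvec N -> (N -> tvec N) -> tvec N).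
Variables (pi : M -> N).
Variables (nablapi : M -> tvec M -> (M -> tvec N) -> tvec N).
Variables (e1 e2 e3 : M -> tvec M) (eps1 eps2 : N -> tvec N).
Variables (f1 f2 kappa1 kappa2 sigma : M -> R).
Hypotheses (hg : riemannian_metric g) (hh : riemannian_metric h).
Hypotheses (hnablaM : levi_civita g nablaM) (hnablaN : levi_civita h nablaN).
Hypothesis hnablapi : pullback_connection pi nablaN nablapi.
Hypothesis hframe : adapted_frame g h pi e1 e2 e3 eps1 eps2.
Hypothesis hdata : integrability_data e1 e2 e3 f1 f2 kappa1 kappa2 sigma.

Implicit Types (a b : M -> R) (p q : M) (X Y : M -> tvec M).

Let i1 : 'I_3 := @Ordinal 3 0 isT.
Let i2 : 'I_3 := @Ordinal 3 1 isT.
Let i3 : 'I_3 := @Ordinal 3 2 isT.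
Let e := tnth [tuple e1; e2; e3].
Let he : orthonormal_frame g e. Proof. exact: adapted_frameM hframe. Qed.
Let heps := adapted_frameN hframe.
Let cM : connection_along id nablaM. Proof. exact: levi_civita_connection hnablaM. Qed.
Let cN : connection_along id nablaN. Proof. exact: levi_civita_connection hnablaN. Qed.
Let cpi : connection_along pi nablapi.
Proof. exact: pullback_connection_along hnablapi. Qed.
Let ve i : vfield (e i). Proof. exact: frame_vfield he i. Qed.
Let v1 : vfield e1. Proof. exact: ve i1. Qed.
Let v2 : vfield e2. Proof. exact: ve i2. Qed.
Let v3 : vfield e3. Proof. exact: ve i3. Qed.
Let Te i p : tangent p (e i p). Proof. exact: vfield_tangent p (ve i). Qed.
Let T1 p : tangent p (e1 p). Proof. exact: vfield_tangent p v1. Qed.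
Let T2 p : tangent p (e2 p). Proof. exact: vfield_tangent p v2. Qed.
Let T3 p : tangent p (e3 p). Proof. exact: vfield_tangent p v3. Qed.
Let veps1 : vfield eps1. Proof. by case: (surface_frame_vfield heps). Qed.
Let veps2 : vfield eps2. Proof. by case: (surface_frame_vfield heps). Qed.
Let Teps1 (q : N) : tangent q (eps1 q). Proof. exact: vfield_tangent q veps1. Qed.
Let Teps2 (q : N) : tangent q (eps2 q). Proof. exact: vfield_tangent q veps2. Qed.

Let d1 p : dmap pi (e1 p) = eps1 (pi p). Proof. by case: (adapted_basic hframe p). Qed.
Let d2 p : dmap pi (e2 p) = eps2 (pi p). Proof. by case: (adapted_basic hframe p). Qed.
Let d3 p : dmap pi (e3 p) = 0. Proof. by case: (adapted_vertical hframe p). Qed.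

Lemma field_along_dmap_frame i : field_along pi (fun p => dmap pi (e i p)).
Proof.
split=> [p|b sb]; last first.
  (* No chain rule is needed: if [b \o pi] were not smooth, [e i] would send
     it to 0 by convention. *)
  rewrite (_ : (fun p => _) = fun p => e i p (fun q => b (pi q))); last first.
    by apply/boolp.funext => p; rewrite dmap_smooth.
  have [sbpi|nsbpi] := boolp.pselect (smooth (fun q => b (pi q))).
    exact: vfield_smooth.
  rewrite (_ : (fun p => _) = fun=> 0); first exact: smooth_cst.
  by apply/boolp.funext => p; rewrite (tangent_junk (Te i p)).
case: i => -[|[|[|//]]] lti; rewrite /e /tnth /=.
- by rewrite d1; exact: Teps1.
- by rewrite d2; exact: Teps2.
- by rewrite d3; exact: tangent0.
Qed.

Let field_eps1 : field_along pi (fun p => eps1 (pi p)).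
Proof.
rewrite (_ : (fun p => _) = fun p => dmap pi (e i1 p)).
  exact: field_along_dmap_frame.
by apply/boolp.funext => p; rewrite d1.
Qed.

Let field_eps2 : field_along pi (fun p => eps2 (pi p)).
Proof.
rewrite (_ : (fun p => _) = fun p => dmap pi (e i2 p)).
  exact: field_along_dmap_frame.
by apply/boolp.funext => p; rewrite d2.
Qed.

(** Expand [X] in the frame with smooth coefficients; the differential is linear, which reduces the
    claim to the frame fields. *)
Lemma field_along_dmap X : vfield X -> field_along pi (fun p => dmap pi (X p)).
Proof.
move=> vX; rewrite (_ : (fun p => _) =
    fun p => \sum_i g p (X p) (e i p) *: dmap pi (e i p)).
  apply: field_along_sum => i.
  exact: field_alongZ (metric_smooth hg vX (ve i)) (field_along_dmap_frame i).
apply/boolp.funext => p; rewrite {1}(frame_coef hg he (vfield_tangent p vX)).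
by rewrite dmap_sum; apply: eq_bigr => i _; rewrite dmapZ.
Qed.

(* d(pi)[e1, e2] = [eps1, eps2], so f1 and f2 are pulled back from N. *)
Lemma structure_functions p :
  f1 p = h (pi p) (bracket eps1 eps2 (pi p)) (eps1 (pi p)) /\
  f2 p = h (pi p) (bracket eps1 eps2 (pi p)) (eps2 (pi p)).
Proof.
have vbr := vfield_bracket veps1 veps2.
have -> : bracket eps1 eps2 (pi p) =
    f1 p *: eps1 (pi p) + f2 p *: eps2 (pi p).
  apply/boolp.funext => b.
  have [sb|nsb] := boolp.pselect (smooth b); last first.
    rewrite !tvecE (tangent_junk (vfield_tangent (pi p) vbr)) //.
    by rewrite (tangent_junk (Teps1 _)) // (tangent_junk (Teps2 _)) // !mulr0 addr0.
  (* Both sides are [e1, e2](b o pi): e3 annihilates b o pi, and e_i(b o pi) = (eps_i b) o pi for i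
     = 1, 2. *)
  transitivity (bracket e1 e2 p (fun q => b (pi q))); last first.
    rewrite (data_bracket12 hdata) !tvecE -(dmap_smooth pi (e1 p) sb).
    rewrite -(dmap_smooth pi (e2 p) sb) -(dmap_smooth pi (e3 p) sb) d1 d2 d3.
    by rewrite tvec0 mulr0 subr0.
  rewrite /bracket.
  rewrite [X in e1 p X](_ : _ = fun q => eps2 (pi q) b); last first.
    by apply/boolp.funext => q; rewrite -d2 dmap_smooth.
  rewrite [X in e2 p X](_ : _ = fun q => eps1 (pi q) b); last first.
    by apply/boolp.funext => q; rewrite -d1 dmap_smooth.
  rewrite -(dmap_smooth pi (e1 p) (vfield_smooth veps2 sb)).
  by rewrite -(dmap_smooth pi (e2 p) (vfield_smooth veps1 sb)) d1 d2.
have [h11 h12 h21 h22] := surface_frame_orthonormal heps (pi p).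
rewrite !(metric_linear hh) //; do ?exact: tangentZ.
by rewrite !(metricZl hh) // h11 h12 h21 h22 !(mulr0, mulr1) addr0 add0r.
Qed.

Let F1 (q : N) := h q (bracket eps1 eps2 q) (eps1 q).
Let F2 (q : N) := h q (bracket eps1 eps2 q) (eps2 q).

(** Since f_j = F_j o pi and d pi(e_i) = eps_i, one has e_i f_j = (eps_i F_j) o pi. *)
Lemma gauss_curvature_pi p :
  gauss_curvature h eps1 eps2 (pi p) =
  e1 p f2 - e2 p f1 - f1 p ^+ 2 - f2 p ^+ 2.
Proof.
have vbr := vfield_bracket veps1 veps2.
have sF1 : smooth F1 by exact: (metric_smooth hh vbr veps1).
have sF2 : smooth F2 by exact: (metric_smooth hh vbr veps2).
have f1E : f1 = fun q => F1 (pi q).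
  by apply/boolp.funext => q; have [] := structure_functions q.
have f2E : f2 = fun q => F2 (pi q).
  by apply/boolp.funext => q; have [] := structure_functions q.
rewrite f1E f2E -(dmap_smooth pi (e1 p) sF2) -(dmap_smooth pi (e2 p) sF1).
by rewrite d1 d2.
Qed.

(** * Connections, Laplacian and traces in the adapted frame *)

Lemma connection_diag p :
  [/\ nablaM p (e1 p) e1 = - f1 p *: e2 p,
      nablaM p (e2 p) e2 = f2 p *: e1 p &
      nablaM p (e3 p) e3 = kappa1 p *: e1 p + kappa2 p *: e2 p].
Proof.
have on := frame_orthonormal he p.
have g11 : g p (e1 p) (e1 p) = 1 by exact: on i1 i1.
have g12 : g p (e1 p) (e2 p) = 0 by exact: on i1 i2.
have g13 : g p (e1 p) (e3 p) = 0 by exact: on i1 i3.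
have g21 : g p (e2 p) (e1 p) = 0 by exact: on i2 i1.
have g22 : g p (e2 p) (e2 p) = 1 by exact: on i2 i2.
have g23 : g p (e2 p) (e3 p) = 0 by exact: on i2 i3.
have g31 : g p (e3 p) (e1 p) = 0 by exact: on i3 i1.
have g32 : g p (e3 p) (e2 p) = 0 by exact: on i3 i2.
have g33 : g p (e3 p) (e3 p) = 1 by exact: on i3 i3.
have gE := (g11, g12, g13, g21, g22, g23, g31, g32, g33).
have diag i : nablaM p (e i p) (e i) =
    (- g p (bracket (e i) e1 p) (e i p)) *: e1 p +
    (- g p (bracket (e i) e2 p) (e i p)) *: e2 p +
    (- g p (bracket (e i) e3 p) (e i p)) *: e3 p.
  rewrite (levi_civita_diag hg he hnablaM).
  exact: (sum_tnth3 (fun E => (- g p (bracket (e i) E p) (e i p)) *: E p)).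
have b0 X : bracket X X p = 0.
  by apply/boolp.funext => b; rewrite /bracket subrr.
have b12 := data_bracket12 hdata p; have b13 := data_bracket13 hdata p.
have b23 := data_bracket23 hdata p.
have T12 : tangent p (f1 p *: e1 p + f2 p *: e2 p).
  by apply: tangent_comb => //; exact: tangentZ.
have g12E w : tangent p w -> g p (bracket e1 e2 p) w =
    f1 p * g p (e1 p) w + f2 p * g p (e2 p) w - 2 * sigma p * g p (e3 p) w.
  move=> Tw; rewrite b12 (metricBl hg) ?(metricZl hg) //; last exact: tangentZ.
  by rewrite (metric_linear hg) ?(metricZl hg) //; exact: tangentZ.
have gN v w : tangent p v -> tangent p w -> g p (- v) w = - g p v w.
  by move=> Tv Tw; rewrite -scaleN1r (metricZl hg) // mulN1r.
have T12' : tangent p (bracket e1 e2 p).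
  exact: vfield_tangent (vfield_bracket _ _).
split.
- rewrite (diag i1 : nablaM p (e1 p) e1 = _) /= b0 (metric0l hg) // g12E // b13.
  rewrite (metricZl hg) // !gE; apply/boolp.funext => b; rewrite !tvecE; ring.
- rewrite (diag i2 : nablaM p (e2 p) e2 = _) /= b0 (metric0l hg) // b23.
  rewrite (bracket_anti e1 e2) gN // g12E //.
  rewrite (metricZl hg) // !gE; apply/boolp.funext => b; rewrite !tvecE; ring.
- rewrite (diag i3 : nablaM p (e3 p) e3 = _) /= b0 (metric0l hg) //.
  rewrite (bracket_anti e1 e3) (bracket_anti e2 e3) b13 b23 !gN //;
    do ?exact: tangentZ.
  rewrite !(metricZl hg) // !gE; apply/boolp.funext => b; rewrite !tvecE; ring.
Qed.

(** The first-order part is minus the derivative of [a] along the sum of the nabla_{e_i} e_i, which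
    is (f2 + kappa1) e1 + (kappa2 - f1) e2. *)
Lemma laplacian_frame a p : smooth a -> laplacian g nablaM a p =
  e1 p (fun q => e1 q a) + e2 p (fun q => e2 q a) + e3 p (fun q => e3 q a)
  - (f2 p + kappa1 p) * e1 p a - (kappa2 p - f1 p) * e2 p a.
Proof.
move=> sa; rewrite (laplacianE hg he hnablaM) //.
have [c11 c22 c33] := connection_diag p.
rewrite (sum_tnth3 (fun E => E p (fun q => E q a) - nablaM p (E p) E a)) /=.
by rewrite c11 c22 c33 !tvecE; ring.
Qed.

Lemma trace_frame (V : lmodType R)
    (B : (M -> tvec M) -> (M -> tvec M) -> M -> V) p :
  (forall Y, vfield Y -> tensorial p (fun X => B X Y p)) ->
  (forall X, vfield X -> tensorial p (fun Y => B X Y p)) ->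
  trace_g g B p = B e1 e1 p + B e2 e2 p + B e3 e3 p.
Proof.
move=> lB rB; rewrite (trace_gE hg he lB rB).
exact: (sum_tnth3 (fun E => B E E p)).
Qed.

Lemma pullback_frame p :
  [/\ nablapi p (e1 p) (fun q => eps1 (pi q)) = - f1 p *: eps2 (pi p),
      nablapi p (e1 p) (fun q => eps2 (pi q)) = f1 p *: eps1 (pi p),
      nablapi p (e2 p) (fun q => eps1 (pi q)) = - f2 p *: eps2 (pi p) &
      nablapi p (e2 p) (fun q => eps2 (pi q)) = f2 p *: eps1 (pi p)] /\
  nablapi p (e3 p) (fun q => eps1 (pi q)) = 0 /\
  nablapi p (e3 p) (fun q => eps2 (pi q)) = 0.
Proof.
have [-> ->] := structure_functions p.
have [c11 c12 c21 c22] := surface_connection hh hnablaN heps (pi p).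
rewrite !(pullback_connectionE hnablapi) // d1 d2 d3.
by rewrite !(nabla0l cN).
Qed.

(** * Sections of the pullback bundle in coordinates, and the tension field *)

(** A section is recorded by its two coefficients, so that covariant derivatives along the e_i
    become operations on pairs of functions and can be iterated. *)
Definition frame_section a b p : tvec N := a p *: eps1 (pi p) + b p *: eps2 (pi p).

Lemma field_along_section a b : smooth a -> smooth b ->
  field_along pi (frame_section a b).
Proof. by move=> sa sb; apply: field_along_comb => //; exact: field_alongZ. Qed.

(** Here [phi] is the connection coefficient in the direction [v]: it is f1, f2 or 0 along e1, e2 or
    e3. *)
Lemma nabla_section p v a b (phi : R) : tangent p v -> smooth a -> smooth b ->
  nablapi p v (fun q => eps1 (pi q)) = - phi *: eps2 (pi p) ->
  nablapi p v (fun q => eps2 (pi q)) = phi *: eps1 (pi p) ->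
  nablapi p v (frame_section a b) =
  (v a + phi * b p) *: eps1 (pi p) + (v b - phi * a p) *: eps2 (pi p).
Proof.
move=> Tv sa sb n1 n2; rewrite /frame_section (nabla_comb cpi) //; last exact: field_alongZ.
rewrite (connection_leibniz cpi) // n1 n2.
by apply/boolp.funext => c; rewrite !tvecE; ring.
Qed.

Lemma nabla_section_frame a b : smooth a -> smooth b ->
  [/\ forall p, nablapi p (e1 p) (frame_section a b) =
        frame_section (fun q => e1 q a + f1 q * b q) (fun q => e1 q b - f1 q * a q) p,
      forall p, nablapi p (e2 p) (frame_section a b) =
        frame_section (fun q => e2 q a + f2 q * b q) (fun q => e2 q b - f2 q * a q) p &
      forall p, nablapi p (e3 p) (frame_section a b) =
        frame_section (fun q => e3 q a) (fun q => e3 q b) p].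
Proof.
move=> sa sb; split=> p; have [[n11 n12 n21 n22] [n31 n32]] := pullback_frame p.
- exact: nabla_section.
- exact: nabla_section.
- rewrite (@nabla_section _ _ _ _ 0) ?n31 ?n32 ?oppr0 ?scale0r //.
  by rewrite !mul0r addr0 subr0.
Qed.

Let tau := frame_section (fun p => - kappa1 p) (fun p => - kappa2 p).

Let sf1 : smooth f1. Proof. by case: (data_smooth hdata). Qed.
Let sf2 : smooth f2. Proof. by case: (data_smooth hdata). Qed.
Let sk1 : smooth kappa1. Proof. by case: (data_smooth hdata). Qed.
Let sk2 : smooth kappa2. Proof. by case: (data_smooth hdata). Qed.

Lemma tensionE : tension g nablaM pi nablapi = tau.
Proof.
apply/boolp.funext => p; rewrite /tension trace_frame.
- have [c11 c22 c33] := connection_diag p.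
  have [[n11 n12 n21 n22] [n31 n32]] := pullback_frame p.
  have -> : (fun q => dmap pi (e1 q)) = fun q => eps1 (pi q) by exact/boolp.funext.
  have -> : (fun q => dmap pi (e2 q)) = fun q => eps2 (pi q) by exact/boolp.funext.
  (* The zero section is written as 0 times eps1 so that the Leibniz rule computes its
     derivative. *)
  rewrite (_ : (fun q => dmap pi (e3 q)) = fun q => 0 *: eps1 (pi q)); last first.
    by apply/boolp.funext => q; rewrite scale0r.
  rewrite (connection_leibniz cpi) //; last exact: smooth_cst.
  rewrite (tangent_cst _ (T3 p)) n11 n22 n31 c11 c22 c33 dmap_comb !dmapZ d1 d2.
  by rewrite /tau /frame_section; apply/boolp.funext => b; rewrite !tvecE; ring.
- move=> Y vY a X Z sa vX vZ.
  have TX := vfield_tangent p vX; have TZ := vfield_tangent p vZ.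
  rewrite (connection_linear cpi) //; last exact: field_along_dmap.
  rewrite (connection_linear cM) // dmap_comb.
  by apply/boolp.funext => b; rewrite !tvecE; ring.
(* Both connections contribute X(a) d pi(Y), and these two terms cancel. *)
- move=> X vX a Y Z sa vY vZ; have TX := vfield_tangent p vX.
  rewrite (_ : (fun q => dmap pi (a q *: Y q + Z q)) =
    fun q => a q *: dmap pi (Y q) + dmap pi (Z q)); last first.
    by apply/boolp.funext => q; rewrite dmap_comb.
  rewrite (nabla_comb cpi) //; do ?exact: field_along_dmap.
  rewrite (nabla_comb cM) // !dmapD !dmapZ.
  by apply/boolp.funext => b; rewrite !tvecE; ring.
Qed.

(** * The two terms of the bitension field: rough Laplacian and curvature trace *)

Let K p := gauss_curvature h eps1 eps2 (pi p).

(** Apply [nabla_section_frame] twice. The second derivatives combine with the first-order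
    correction into the Laplacians. That correction also contributes f1 (f2 + kappa1) + f2 (kappa2 -
    f1) to the coupling of the components, where the products f1 f2 cancel and the sum of the
    kappa_i f_i remains. *)
Lemma rough_laplacian_section a b p : smooth a -> smooth b ->
  trace_g g (fun X Y q =>
    nablapi q (X q) (fun r => nablapi r (Y r) (frame_section a b))
    - nablapi q (nablaM q (X q) Y) (frame_section a b)) p =
  (laplacian g nablaM a p + 2 * (f1 p * e1 p b + f2 p * e2 p b)
   + b p * ((e1 p f1 - kappa1 p * f1 p) + (e2 p f2 - kappa2 p * f2 p))
   - a p * (f1 p ^+ 2 + f2 p ^+ 2)) *: eps1 (pi p) +
  (laplacian g nablaM b p - 2 * (f1 p * e1 p a + f2 p * e2 p a)
   - a p * ((e1 p f1 - kappa1 p * f1 p) + (e2 p f2 - kappa2 p * f2 p))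
   - b p * (f1 p ^+ 2 + f2 p ^+ 2)) *: eps2 (pi p).
Proof.
move=> sa sb; have fs := field_along_section sa sb.
have TM X Y : vfield X -> vfield Y -> tangent p (nablaM p (X p) Y).
  by move=> vX vY; exact: (vfield_tangent p (connection_smooth cM vX vY)).
have fn X : vfield X -> field_along pi (fun r => nablapi r (X r) (frame_section a b)).
  by move=> vX; exact: (connection_smooth cpi vX fs).
rewrite trace_frame.
- have [c11 c22 c33] := connection_diag p.
  have [n1 n2 n3] := nabla_section_frame sa sb.
  rewrite (boolp.funext n1) (boolp.funext n2) (boolp.funext n3).
  have s1 c : smooth c -> smooth (fun q => e1 q c) by exact: vfield_smooth.
  have s2 c : smooth c -> smooth (fun q => e2 q c) by exact: vfield_smooth.
  have s3 c : smooth c -> smooth (fun q => e3 q c) by exact: vfield_smooth.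
  have s1a := s1 a sa; have s1b := s1 b sb; have s2a := s2 a sa.
  have s2b := s2 b sb; have s3a := s3 a sa; have s3b := s3 b sb.
  have f1a := smoothM sf1 sa; have f1b := smoothM sf1 sb.
  have f2a := smoothM sf2 sa; have f2b := smoothM sf2 sb.
  (* Each first derivative is again a [frame_section], so the same rule gives the second one. *)
  have [-> _ _] := nabla_section_frame (smoothD s1a f1b) (smoothB s1b f1a).
  have [_ -> _] := nabla_section_frame (smoothD s2a f2b) (smoothB s2b f2a).
  have [_ _ ->] := nabla_section_frame s3a s3b.
  rewrite c11 c22 c33 (connection_linear cpi) ?(nablaZl cpi) //;
    try exact: tangentZ.
  rewrite n1 n2 !laplacian_frame // /frame_section.
  rewrite !(tangentBfun (T1 p)) ?(tangentDfun (T1 p)) //.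
  rewrite !(tangentBfun (T2 p)) ?(tangentDfun (T2 p)) //.
  rewrite !(tangent_leibniz (T1 p)) ?(tangent_leibniz (T2 p)) //.
  by apply/boolp.funext => c; rewrite !tvecE; ring.
- move=> Y vY c X Z sc vX vZ.
  have TX := vfield_tangent p vX; have TZ := vfield_tangent p vZ.
  rewrite (connection_linear cpi) //; last exact: fn.
  rewrite (connection_linear cM) // (connection_linear cpi) //; try exact: TM.
  by apply/boolp.funext => d; rewrite !tvecE; ring.
- move=> X vX c Y Z sc vY vZ; have TX := vfield_tangent p vX.
  have TY := vfield_tangent p vY; have TZ := vfield_tangent p vZ.
  rewrite (_ : (fun r => nablapi r (c r *: Y r + Z r) (frame_section a b)) =
    fun r => c r *: nablapi r (Y r) (frame_section a b)
             + nablapi r (Z r) (frame_section a b)); last first.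
    apply/boolp.funext => r; rewrite (connection_linear cpi) //;
      exact: vfield_tangent.
  rewrite (nabla_comb cpi) //; do ?exact: fn.
  have TXY := TM _ _ vX vY; have TXZ := TM _ _ vX vZ.
  rewrite (nabla_comb cM) // !(nablaDl cpi) ?(nablaZl cpi) //;
    do ?[exact: tangentZ | by apply: tangentD; exact: tangentZ].
  by apply/boolp.funext => d; rewrite !tvecE; ring.
Qed.

(** The e3 term is 0 and the others are b R(eps1, eps2) eps1 = - K b eps2 and a R(eps2, eps1) eps2 =
    - K a eps1. The trace is subtracted in [bitension], whence the contribution K tau. *)
Lemma curvature_trace_section a b p : smooth a -> smooth b ->
  trace_g g (fun X Y q =>
    curvature nablaN (pi q) (dmap pi (X q)) (frame_section a b q) (dmap pi (Y q))) p =
  - K p *: frame_section a b p.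
Proof.
move=> sa sb; have fs := field_along_section sa sb.
have Ts := field_tangent p fs.
have Td X : vfield X -> tangent (pi p) (dmap pi (X p)).
  by move=> vX; exact: (field_tangent p (field_along_dmap vX)).
have lin1 := curvature_linear1 hh heps cN.
have lin3 := curvature_linear3 hh heps cN.
rewrite trace_frame.
- have [R1 R2] := surface_curvature hh hnablaN heps (pi p).
  rewrite d1 d2 d3 /frame_section.
  have T0 : tangent (pi p) (0 : tvec N) by exact: tangent0.
  have cs := curvature_same hh heps cN.
  have cZ := curvatureZ2 hh heps cN.
  rewrite !(curvature_linear2 hh heps cN) //; do ?exact: tangentZ.
  rewrite !cZ // !cs // (curvatureN hh heps cN (Teps1 _) (Teps2 _)) // R1 R2.
  rewrite !(curvature0l hh heps cN) //.
  by apply/boolp.funext => c; rewrite /K !tvecE; ring.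
- by move=> Y vY c X Z sc vX vZ; rewrite dmap_comb lin1 //; exact: Td.
- by move=> X vX c Y Z sc vY vZ; rewrite dmap_comb lin3 //; exact: Td.
Qed.

(** * The terms in the derivatives of f, and the f-biharmonic equation in components *)

Lemma nabla_grad_section f a b p : smooth f -> smooth a -> smooth b ->
  nablapi p (grad g f p) (frame_section a b) =
  (e1 p f * (e1 p a + f1 p * b p) + e2 p f * (e2 p a + f2 p * b p)
   + e3 p f * e3 p a) *: eps1 (pi p) +
  (e1 p f * (e1 p b - f1 p * a p) + e2 p f * (e2 p b - f2 p * a p)
   + e3 p f * e3 p b) *: eps2 (pi p).
Proof.
move=> sf sa sb; have fs := field_along_section sa sb.
rewrite (gradE hg he sf) (sum_tnth3 (fun E => E p f *: E p)).
have [n1 n2 n3] := nabla_section_frame sa sb.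
rewrite !(nablaDl cpi) ?(nablaZl cpi) ?n1 ?n2 ?n3 //;
  do ?[exact: tangentZ | by apply: tangentD; exact: tangentZ].
by rewrite /frame_section; apply/boolp.funext => c; rewrite !tvecE; ring.
Qed.

(** First-order terms obey the Leibniz rule; each second derivative adds a cross term, and together
    these form 2 <grad f, grad a>. *)
Lemma laplacianM f a p : smooth f -> smooth a ->
  laplacian g nablaM (fun q => f q * a q) p =
  f p * laplacian g nablaM a p + a p * laplacian g nablaM f p
  + 2 * (e1 p f * e1 p a + e2 p f * e2 p a + e3 p f * e3 p a).
Proof.
move=> sf sa; rewrite !laplacian_frame //; last exact: smoothM.
have leib E : vfield E -> E p (fun q => E q (fun r => f r * a r)) =
    f p * E p (fun q => E q a) + a p * E p (fun q => E q f)
    + 2 * (E p f * E p a).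
  move=> vE; have TE := vfield_tangent p vE.
  rewrite [X in E p X](_ : _ = fun q => E q f * a q + f q * E q a); last first.
    apply/boolp.funext => q.
    by rewrite (tangent_leibniz (vfield_tangent q vE)).
  have sEf : smooth (fun q => E q f) by exact: vfield_smooth.
  have sEa : smooth (fun q => E q a) by exact: vfield_smooth.
  rewrite (tangentDfun TE) ?(tangent_leibniz TE) //; try exact: smoothM.
  ring.
by rewrite !leib // (tangent_leibniz (T1 p)) ?(tangent_leibniz (T2 p)) //; ring.
Qed.

Lemma laplacianN a p : smooth a ->
  laplacian g nablaM (fun q => - a q) p = - laplacian g nablaM a p.
Proof.
move=> sa; rewrite !laplacian_frame //; last exact: smoothN.
have neg E : vfield E -> (fun q => E q (fun r => - a r)) = fun q => - E q a.
  move=> vE; apply/boolp.funext => q.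
  by rewrite (tangentNfun (vfield_tangent q vE)).
have sE E : vfield E -> smooth (fun q => E q a) by move=> vE; exact: vfield_smooth.
rewrite !neg // (tangentNfun (T1 p)) ?(tangentNfun (T2 p)) ?(tangentNfun (T3 p)) //;
  do ?exact: sE.
by rewrite !(tangentNfun (T1 p)) ?(tangentNfun (T2 p)) //; ring.
Qed.

(** The two left-hand sides are equal vectors at every point. In the component along eps1, the terms
    - f Delta(kappa1), - kappa1 Delta(f) and - 2 <grad f, grad kappa1> add up to - Delta(f kappa1),
    while - 2 f f_i e_i(kappa2) and - 2 f_i kappa2 e_i(f) add up to - 2 f_i e_i(f kappa2); the
    component along eps2 is similar. *)
Lemma f_biharmonicE f : smooth f ->
  let fk1 := fun p => f p * kappa1 p in
  let fk2 := fun p => f p * kappa2 p in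
  f_biharmonic g nablaM nablaN pi nablapi f <->
  forall p,
    (- laplacian g nablaM fk1 p
     - 2 * (f1 p * e1 p fk2 + f2 p * e2 p fk2)
     - f p * kappa2 p *
       ((e1 p f1 - kappa1 p * f1 p) + (e2 p f2 - kappa2 p * f2 p))
     + f p * kappa1 p * (- K p + (f1 p ^+ 2 + f2 p ^+ 2))) *: eps1 (pi p) +
    (- laplacian g nablaM fk2 p
     + 2 * (f1 p * e1 p fk1 + f2 p * e2 p fk1)
     + f p * kappa1 p *
       ((e1 p f1 - kappa1 p * f1 p) + (e2 p f2 - kappa2 p * f2 p))
     + f p * kappa2 p * (- K p + (f1 p ^+ 2 + f2 p ^+ 2))) *: eps2 (pi p) = 0.
Proof.
move=> sf fk1 fk2; have sk1N := smoothN sk1; have sk2N := smoothN sk2.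
rewrite /f_biharmonic /bitension tensionE.
(* The 0 on the right is replaced by the other left-hand side, so both implications come down to the
   same identity. *)
split=> H p; rewrite -[RHS](H p) rough_laplacian_section //
  curvature_trace_section // nabla_grad_section // !laplacianM // !laplacianN //
  !(tangent_leibniz (T1 p)) ?(tangent_leibniz (T2 p)) //
  !(tangentNfun (T1 p)) ?(tangentNfun (T2 p)) ?(tangentNfun (T3 p)) //
  /tau /frame_section; apply/boolp.funext => c; rewrite !tvecE; ring.
Qed.

End Submersion.

(** * The f-biharmonic equation as a system of two scalar equations *)

Theorem proposition3p1 (R : realType)
  (M : smoothManifold R 3) (N : smoothManifold R 2)
  (g : M -> tvec M -> tvec M -> R) (h : N -> tvec N -> tvec N -> R)
  (nablaM : M -> tvec M -> (M -> tvec M) -> tvec M)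
  (nablaN : N -> tvec N -> (N -> tvec N) -> tvec N)
  (pi : M -> N)
  (nablapi : M -> tvec M -> (M -> tvec N) -> tvec N)
  (e1 e2 e3 : M -> tvec M) (eps1 eps2 : N -> tvec N)
  (f1 f2 kappa1 kappa2 sigma : M -> R) (f : M -> R)
  (hg : riemannian_metric g) (hh : riemannian_metric h)
  (hnablaM : levi_civita g nablaM) (hnablaN : levi_civita h nablaN)
  (hpi : riemannian_submersion g h pi)
  (hnablapi : pullback_connection pi nablaN nablapi)
  (hframe : adapted_frame g h pi e1 e2 e3 eps1 eps2)
  (hdata : integrability_data e1 e2 e3 f1 f2 kappa1 kappa2 sigma)
  (hf : smooth f) (hf0 : forall p, 0 < f p) :
  let Delta := laplacian g nablaM in
  let KN := fun p => riemann4 h nablaN (pi p)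
    (eps1 (pi p)) (eps2 (pi p)) (eps1 (pi p)) (eps2 (pi p)) in
  let fk1 := fun p => f p * kappa1 p in
  let fk2 := fun p => f p * kappa2 p in
  (forall p, KN p = e1 p f2 - e2 p f1 - f1 p ^+ 2 - f2 p ^+ 2) /\
  (f_biharmonic g nablaM nablaN pi nablapi f <->
   forall p,
     - Delta fk1 p
     - 2 * (f1 p * e1 p fk2 + f2 p * e2 p fk2)
     - f p * kappa2 p *
       ((e1 p f1 - kappa1 p * f1 p) + (e2 p f2 - kappa2 p * f2 p))
     + f p * kappa1 p * (- KN p + (f1 p ^+ 2 + f2 p ^+ 2)) = 0
     /\
     - Delta fk2 p
     + 2 * (f1 p * e1 p fk1 + f2 p * e2 p fk1)
     + f p * kappa1 p *
       ((e1 p f1 - kappa1 p * f1 p) + (e2 p f2 - kappa2 p * f2 p))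
     + f p * kappa2 p * (- KN p + (f1 p ^+ 2 + f2 p ^+ 2)) = 0).
Proof.
have heps := adapted_frameN hframe.
move=> Delta KN fk1 fk2.
(* With the convention of [riemann4], R_1212 is <R(eps1, eps2) eps2, eps1>, and R(eps1, eps2) eps2 =
   K eps1. *)
have KNE p : KN p = gauss_curvature h eps1 eps2 (pi p).
  have [Teps1 _] : vfield eps1 /\ vfield eps2 by exact: surface_frame_vfield heps.
  have [h11 _ _ _] := surface_frame_orthonormal heps (pi p).
  have [_ R122] := surface_curvature hh hnablaN heps (pi p).
  rewrite /KN /riemann4 R122 (metricZl hh) ?h11 ?mulr1 //; exact: vfield_tangent.
split=> [p|].
  by rewrite KNE; exact: (gauss_curvature_pi hh hframe hdata).
rewrite (f_biharmonicE hg hh hnablaM hnablaN hnablapi hframe hdata hf).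
split=> H p; rewrite ?KNE; last first.
  by have [] := H p; rewrite !KNE => -> ->; rewrite !scale0r addr0.
(* Linear independence of eps1 and eps2 at [pi p] makes both coefficients vanish. *)
by split; have [? ?] := surface_frame_free hh heps (H p).
Qed.
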